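(* (First cluster theorem.) (1) The $\Omega_1$-cluster contains each $\Omega_n$ for $n\ge 1$, a weak enumeration functional, and the weak $\Omega_{\mathsf{BW}}$-functional. (2) The $\Omega$-cluster contains $\Omega_{\mathrm{fin}}$, $\Omega_{\le n}$ (for $n\ge 1$), $\Omega_{\#,\mathrm{fin}}$, $\Omega_{\ge\#,\mathrm{fin}}$, an enumeration functional, and $\Omega_{\mathsf{BW}}$.
   Context: Functionals, for $X\subset[0,1]$ and $n\in\mathbb N$ (all are partial and of type rank 3): - $\Omega_{\mathrm{fin}}$ is defined when $X$ is finite and outputs a finite sequence that includes all elements of $X$. - $\Omega_n$ is defined if $|X|=n$ and outputs a finite sequence that includes all elements of $X$. - $\Omega_{\le n}$ is defined if $|X|\le n$ and outputs a finite sequence that includes all elements of $X$. Write $\Omega:=\Omega_{\le 1}$. - $\Omega_{\#,\mathrm{fin}}$ is defined when $X$ is finite and outputs $|X|$. - $\Omega_{\ge\#,\mathrm{fin}}$ is defined when $X$ is finite and outputs some $n\ge|X|$. - An enumeration functional takes as input $A\subset[0,1]$ and $Y:[0,1]\to\mathbb N$ injective on $A$ (i.e. $Y(x)=Y(y)\to x=y$ for $x,y\in A$) and outputs an enumeration of $A$, i.e. a sequence listing exactly the elements of $A$ (a designated null sequence if $A=\emptyset$). - An $\Omega_{\mathsf{BW}}$-functional takes the same inputs $A,Y$ and outputs $\sup A$. - A weak enumeration functional, resp. weak $\Omega_{\mathsf{BW}}$-functional, is one that only works if in addition $Y$ is surjective on $A$, i.e. for every $n\in\mathbb N$ there is $x\in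 A$ with $Y(x)=n$. Clusters: the $\Omega$-cluster (resp. $\Omega_1$-cluster) is the class of partial functionals computationally equivalent to $\Omega$ (resp. $\Omega_1$) modulo $\exists^2$, i.e. $\Phi$ is computable in $\Omega$ and $\exists^2$, and $\Omega$ is computable in $\Phi$ and $\exists^2$ (same for $\Omega_1$). When a functional is given by an incomplete description, a class of functionals is being defined; such a class is in the $\Omega$-cluster if $\Omega$ is computable, modulo $\exists^2$, in all elements of the class and at least one element of the class is in the $\Omega$-cluster (same for $\Omega_1$). Here $\exists^2:\mathbb N^{\mathbb N}\to\{0,1\}$ satisfies $\exists^2(f)=0$ iff $f(n)=0$ for some $n$. Representations: reals are fast-converging Cauchy sequences of rationals ($|q_n-q_{n+i}|<2^{-n}$); functions on $[0,1]$ or $\mathbb R$ are functionals respecting equality of reals; sets of reals are given by characteristic functions. In the presence of $\exists^2$ it is immaterial whether sets live in $\mathbb N^{\mathbb N}$, $2^{\mathbb N}$, $[0,1]$ or $\mathbb R$. Computability: Kleene's S1–S9, where partial functionals of type rank $\le 3$ (taking only total arguments, possibly undefined) are allowed as oracles. That is, $\{e\}(\vec\phi)\simeq a$ is the least relation closed under Kleene's schemes: successor, constants, projection to a number argument, composition, primitive recursion, permutation of arguments, application of an argument, and S9: $\{e\}(m,\vec\phi,\vec\psi)\simeq\{m\}(\vec\phi)$. An application of $\phi_i$ to functionals $\lambda\vec\xi.\{d\}(\vec\xi,\vec\phi)$ has a value iff these functionals are total and $\phi_i$ is defined on them. A partial functional $\psi$ is computable in $\vec\phi$ if for some $e$, $\{e\}(\vec\xi,\vec\phi)\simeq\psi(\vec\xi)$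 for all total $\vec\xi$ for which $\psi(\vec\xi)$ is defined. Functionals with outputs coded in $\mathbb N^{\mathbb N}$ are viewed as $\mathbb N$-valued with extra arguments. *)

(* Defs.v *)
From HB Require Import structures.
From mathcomp Require Import all_boot all_order all_algebra.
From mathcomp Require Import boolp classical_sets cardinality reals topology.
From mathcomp Require Import normedtype sequences.

Set Implicit Arguments.
Unset Strict Implicit.
Unset Printing Implicit Defensive.

Import Order.TTheory GRing.Theory Num.Theory.
Import numFieldNormedType.Exports.

Local Open Scope classical_set_scope.
Local Open Scope ring_scope.
Local Open Scope card_scope.

(** * Finite types and partial functionals *)

(** [Fn [:: t1; ..; tk]] is the type of functionals t1 -> .. -> tk -> N. *)
Inductive ty := Fn of seq ty.

Fixpoint value (t : ty) : Type :=
  let: Fn s := t in foldr (fun u T => value u -> T) nat s.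

Definition args (s : seq ty) : Type :=
  foldr (fun u T => (value u * T)%type) unit s.

Definition tN := Fn [::].
Definition tN1 := Fn [:: tN].
Definition tN2 := Fn [:: tN1].

Fixpoint app (s : seq ty) : value (Fn s) -> args s -> nat :=
  match s with
  | [::] => fun v _ => v
  | t :: s' => fun v a => @app s' (v a.1) a.2
  end.

Fixpoint acat (s t : seq ty) : args s -> args t -> args (s ++ t) :=
  match s with
  | [::] => fun _ b => b
  | u :: s' => fun a b => (a.1, @acat s' t a.2 b)
  end.

(** Partial functionals take total arguments only. *)
Definition pfun (s : seq ty) : Type := args s -> option nat.

(** * Kleene's S1-S9 *)

(** An argument of a computation is a functional that may be partial; numbers
    are the case [s = [::]]. *)
Inductive input := Inp (s : seq ty) of pfun s.

Definition num (n : nat) : input := @Inp [::] (fun _ => Some n).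

Definition total_input (t : ty) : value t -> input :=
  match t with Fn s => fun v => @Inp s (fun a => Some (app v a)) end.

Fixpoint inputs (s : seq ty) : args s -> seq input :=
  match s with
  | [::] => fun _ => [::]
  | t :: s' => fun a => total_input a.1 :: @inputs s' a.2
  end.

(** Locked, since unary indices are far too large to compute with. *)
Fact idx_key : unit. Proof. exact: tt. Qed.
Definition idx : seq nat -> nat := locked_with idx_key CodeSeq.code.

Lemma idxE : idx = CodeSeq.code.
Proof. exact: unlock. Qed.

(** [kleene e phi n] is {e}(phi) = n.  [S78] applies the [i]-th argument of the
    computation to the functionals lambda xi. {d_j}(xi, phi); by [kleenes], each
    of these has to be total and equal to the corresponding entry of [a]. *)
Inductive kleene : nat -> seq input -> nat -> Prop :=
| S1 n phi : kleene (idx [:: 1%N]) (num n :: phi) n.+1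
| S2 q phi : kleene (idx [:: 2%N; q]) phi q
| S3 n phi : kleene (idx [:: 3%N]) (num n :: phi) n
| S4 d1 d2 phi b a :
    kleene d2 phi b -> kleene d1 (num b :: phi) a ->
    kleene (idx [:: 4%N; d1; d2]) phi a
| S5_0 d1 d2 phi a :
    kleene d1 phi a -> kleene (idx [:: 5%N; d1; d2]) (num 0 :: phi) a
| S5_S d1 d2 n phi b a :
    kleene (idx [:: 5%N; d1; d2]) (num n :: phi) b ->
    kleene d2 (num n :: num b :: phi) a ->
    kleene (idx [:: 5%N; d1; d2]) (num n.+1 :: phi) a
| S6 d p phi a :
    perm_eq p (iota 0 (size phi)) ->
    kleene d [seq nth (num 0) phi i | i <- p] a ->
    kleene (idx [:: 6%N, d & p]) phi a
| S78 i ds phi s (F : pfun s) (a : args s) n :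
    onth phi i = Some (Inp F) -> kleenes ds phi a -> F a = Some n ->
    kleene (idx [:: 8%N, i & ds]) phi n
| S9 k m phi psi a :
    size phi = k -> kleene m phi a ->
    kleene (idx [:: 9%N; k]) (num m :: phi ++ psi) a
with kleenes : seq nat -> seq input -> forall s : seq ty, args s -> Prop :=
| Kl_nil phi : @kleenes [::] phi [::] tt
| Kl_cons d ds phi r (v : value (Fn r)) s (a : args s) :
    (forall xi : args r, kleene d (inputs xi ++ phi) (app v xi)) ->
    kleenes ds phi a ->
    @kleenes (d :: ds) phi (Fn r :: s) (v, a).

Definition computable_in (s : seq ty) (psi : pfun s) (phi : seq input) : Prop :=
  exists e : nat, forall (xi : args s) (a : nat),
    psi xi = Some a -> kleene e (inputs xi ++ phi) a.

Definition E2 : value tN2 :=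
  fun f : nat -> nat => if `[< exists n, f n = 0%N >] then 0%N else 1%N.

(** * Clusters

    An incompletely described functional is the class of all partial functionals
    that meet the description.  This applies to Omega and Omega_1 themselves:
    "computable in Omega" then means computable in every element of the class,
    and "Omega is computable in Phi" that Phi computes some element of it. *)

Definition in_cluster (s0 s : seq ty) (W : pfun s0 -> Prop) (Phi : pfun s) :
    Prop :=
  (forall w, W w -> computable_in Phi [:: Inp w; total_input E2]) /\
  (exists2 w, W w & computable_in w [:: Inp Phi; total_input E2]).

Definition class_in_cluster (s0 s : seq ty) (W : pfun s0 -> Prop)
    (C : pfun s -> Prop) : Prop :=
  (forall Phi, C Phi ->
     exists2 w, W w & computable_in w [:: Inp Phi; total_input E2]) /\
  (exists2 Phi, C Phi & in_cluster W Phi).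

(** The partial functionals with domain [P] whose output [v] on input [a]
    satisfies [Q a v].  An output of type [Fn t] is read as a number depending
    on extra arguments [t]. *)
Definition described (s t : seq ty) (P : args s -> Prop)
    (Q : args s -> value (Fn t) -> Prop) (Phi : pfun (s ++ t)) : Prop :=
  forall a,
    (P a -> exists2 v, Q a v & forall b, Phi (acat a b) = Some (app v b)) /\
    (~ P a -> forall b, Phi (acat a b) = None).

(** * Reals, functions on [0,1] and subsets of [0,1] *)

(** The code of the list [i; j; k] stands for (i - j) / (k + 1), so that every
    rational has a code. *)
Definition rat_of_code (n : nat) : rat :=
  let l := CodeSeq.decode n in
  ((nth 0%N l 0)%:R - (nth 0%N l 1)%:R) / (nth 0%N l 2).+1%:R.

Definition names (R : realType) (f : nat -> nat) (x : R) : Prop :=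
  (forall n i, `|rat_of_code (f n) - rat_of_code (f (n + i)%N)| < 2%:R ^- n) /\
  (fun n => ratr (rat_of_code (f n)) : R) @ \oo --> x.

Definition I01 (R : realType) : set R := [set x | 0 <= x <= 1].

Definition fun01 (R : realType) (G : value tN2) : Prop :=
  forall (x : R) f g, I01 x -> names f x -> names g x -> G f = G g.

Definition charfun01 (R : realType) (F : value tN2) : Prop :=
  fun01 R F /\
  forall (x : R) f, I01 x -> names f x -> F f = 0%N \/ F f = 1%N.

Definition carrier (R : realType) (F : value tN2) : set R :=
  [set x | I01 x /\ exists2 f, names f x & F f = 1%N].
Arguments carrier : clear implicits.

(** * Codes of sequences of reals *)

(** [g : N -> N] codes the finite sequence of length [g 0] whose [i]-th entry is
    the real named by [entry g i]; the names are interleaved. *)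
Definition entry (g : nat -> nat) (i : nat) : nat -> nat :=
  fun m => g (m * g 0 + i)%N.+1.

Definition fin_includes (R : realType) (g : nat -> nat) (X : set R) : Prop :=
  (forall i, (i < g 0)%N -> exists x : R, names (entry g i) x) /\
  (forall x, X x -> exists2 i, (i < g 0)%N & names (entry g i) x).

(** The designated null sequence is the one that is constantly 0. *)
Definition enumerates (R : realType) (v : nat -> nat -> nat) (A : set R) : Prop :=
  (A = set0 /\ forall n m, v n m = 0%N) \/
  (A !=set0 /\ (forall n, exists2 x, A x & names (v n) x) /\
   (forall x, A x -> exists n, names (v n) x)).

(** * The functionals *)

Section Functionals.
Variable R : realType.

Definition set_input (D : set R -> Prop) (a : args [:: tN2]) : Prop :=
  charfun01 R a.1 /\ D (carrier R a.1).

Definition Omega_on (D : set R -> Prop) : pfun [:: tN2; tN] -> Prop :=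
  @described [:: tN2] [:: tN] (set_input D)
    (fun a g => fin_includes g (carrier R a.1)).

Definition Omega_fin := Omega_on (fun X => finite_set X).
Definition Omega_eq (n : nat) := Omega_on (fun X => X #= `I_n).
Definition Omega_le (n : nat) := Omega_on (fun X => X #<= `I_n).
Definition Omega := Omega_le 1.
Definition Omega_1 := Omega_eq 1.

Definition Omega_card_fin : pfun [:: tN2] -> Prop :=
  @described [:: tN2] [::] (set_input (fun X => finite_set X))
    (fun a n => carrier R a.1 #= `I_n).

Definition Omega_ge_card_fin : pfun [:: tN2] -> Prop :=
  @described [:: tN2] [::] (set_input (fun X => finite_set X))
    (fun a n => carrier R a.1 #<= `I_n).

(** Inputs are pairs (A, Y) with Y : [0,1] -> N injective on A, and in the weak
    case also surjective. *)
Definition inj_on (A : set R) (Y : value tN2) : Prop :=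
  forall x y f g, A x -> A y -> names f x -> names g y -> Y f = Y g -> x = y.

Definition surj_on (A : set R) (Y : value tN2) : Prop :=
  forall n, exists x f, [/\ A x, names f x & Y f = n].

Definition inj_input (a : args [:: tN2; tN2]) : Prop :=
  [/\ charfun01 R a.1, fun01 R a.2.1 & inj_on (carrier R a.1) a.2.1].

Definition bij_input (a : args [:: tN2; tN2]) : Prop :=
  inj_input a /\ surj_on (carrier R a.1) a.2.1.

Definition enum_on (P : args [:: tN2; tN2] -> Prop) :
    pfun [:: tN2; tN2; tN; tN] -> Prop :=
  @described [:: tN2; tN2] [:: tN; tN] P
    (fun a v => enumerates v (carrier R a.1)).

(** [sup set0 = 0], which is the supremum of the empty subset of [0,1]. *)
Definition BW_on (P : args [:: tN2; tN2] -> Prop) :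
    pfun [:: tN2; tN2; tN] -> Prop :=
  @described [:: tN2; tN2] [:: tN] P (fun a g => names g (sup (carrier R a.1))).

Definition enumeration := enum_on inj_input.
Definition weak_enumeration := enum_on bij_input.
Definition Omega_BW := BW_on inj_input.
Definition weak_Omega_BW := BW_on bij_input.

End Functionals.

(* Main.v *)
(** In one direction, a set with at most one element [x] is replaced by the set of
    its copies (1 + x) / 2^(i+1), finitely or infinitely many: they form the sets
    of exactly n elements and, with [i] as the value of Y, the bijections with N
    that the other functionals take as arguments.  If n0 is the bound given for
    the empty set, the bound for n0 + 1 copies exceeds n0 unless the set is empty.

    In the other direction each functional has an element whose output depends on
    its input only, computed from the answers to the questions whether a set meets
    (c, q] for rational c, q.
    - For an injective Y these are asked of the fibers of Y, which have at most
      one element.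
    - For a finite X, the largest x in X with s < x <= q is the only x in X with
      s < x <= q such that no element of X lies in (x, q].  By the recursion
      theorem this condition is the same question with x in the place of s, and
      the recursion ends because X is finite.
    - For a set of known size n, Omega_1 yields its last element in a suitable
      ranking, where being last is a question about a set of size n - 1. *)
From mathcomp Require Import all_boot all_order all_algebra.
From mathcomp Require Import boolp classical_sets cardinality reals topology.
From mathcomp Require Import normedtype sequences.
From mathcomp Require Import zify ring lra.
Require Import Defs.

Set Implicit Arguments.
Unset Strict Implicit.
Unset Printing Implicit Defensive.

Import Order.TTheory GRing.Theory Num.Theory.
Import numFieldNormedType.Exports.

Local Open Scope nat_scope.

(** * Indices of computations *)

(** Two obstacles shape the programs. Hence a list is only ever searched for a point of a given set,
    and reals are rebuilt from the answers: entry n of the name of x is the least code of a rational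
    c with c < x <= c + 2^-(n+1), found from questions c < x alone. Moreover, an oracle call is
    undefined outside the domain of the oracle or when an argument is not total. So a set is
    submitted only if its size is known to be admissible, and guards are evaluated before what they
    protect. $\Omega_1$ cannot even be asked about the empty set, which is why points are ranked
    when the size is known: some point comes last whether or not the interval is met. As to the
    copies, 1 + x lies in [1, 2], so distinct i give distinct points of (0, 1] even for x = 0, and x
    is recovered from a copy y as 2^(i+1) y - 1. *)

(** A code maps the number of arguments to a Kleene index.  The argument at level
    [l] is the [l]-th one counted from the end of the context: levels do not
    change when arguments are added in front. *)
Definition code := nat -> nat.

Definition lookup (phi : seq input) (l : nat) := onth (rev phi) l.

Definition args_at (phi : seq input) (ls : seq nat) :=
  [seq nth (num 0) (rev phi) l | l <- ls].

(** The quantification over [psi] makes evaluation stable under additional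
    arguments, so that codes can be used under binders without renaming. *)
Definition Ev (t : code) (phi : seq input) (a : nat) :=
  forall psi, kleene (t (size (psi ++ phi))) (psi ++ phi) a.

Lemma lookup_cat psi phi l v :
  lookup phi l = Some v -> lookup (psi ++ phi) l = Some v.
Proof.
rewrite /lookup rev_cat => h; rewrite onth_cat; case: ltnP => // hs.
by move: h; rewrite onth_default.
Qed.

Lemma lookup_cons x phi l v : lookup phi l = Some v -> lookup (x :: phi) l = Some v.
Proof. exact: (@lookup_cat [:: x]). Qed.

Lemma lookup_size x phi : lookup (x :: phi) (size phi) = Some x.
Proof. by rewrite /lookup rev_cons -cats1 onth_cat size_rev ltnn subnn. Qed.

Lemma lookup_lt phi l v : lookup phi l = Some v -> l < size phi.
Proof. by rewrite /lookup => h; rewrite -size_rev -onthTE h. Qed.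

Lemma lookup_onth phi l v : lookup phi l = Some v ->
  onth phi (size phi - l.+1) = Some v.
Proof.
move=> h; have lt := lookup_lt h; move: h.
by rewrite /lookup !onthE map_rev nth_rev ?size_map.
Qed.

Lemma lookup_nth phi l v : lookup phi l = Some v ->
  nth (num 0) (rev phi) l = v.
Proof. by move=> h; apply: (@onth_nth _ (num 0) _ _ _ h). Qed.

Lemma Ev0 t phi a : Ev t phi a -> kleene (t (size phi)) phi a.
Proof. exact: (fun h => h [::]). Qed.

Lemma EvW psi t phi a : Ev t phi a -> Ev t (psi ++ phi) a.
Proof. by move=> h psi'; rewrite catA; apply: h. Qed.

Lemma EvC x t phi a : Ev t phi a -> Ev t (x :: phi) a.
Proof. exact: (@EvW [:: x]). Qed.

Lemma kleene_perm d p (phi : seq input) a :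
  uniq p -> all (fun i => i < size phi) p ->
  kleene d ([seq nth (num 0) phi i | i <- p] ++
            [seq nth (num 0) phi i | i <- iota 0 (size phi) & i \notin p]) a ->
  kleene (idx [:: 6, d & p ++ [seq i <- iota 0 (size phi) | i \notin p]]) phi a.
Proof.
move=> up ltp h; apply: S6; last by rewrite map_cat.
apply: uniq_perm; rewrite ?iota_uniq // ?cat_uniq ?up ?filter_uniq ?iota_uniq ?andbT //=.
  by apply/hasPn => i; rewrite mem_filter => /andP[].
move=> i; rewrite mem_cat mem_filter; case: (boolP (i \in p)) => //= ip.
by rewrite mem_iota (allP ltp).
Qed.

Definition permute (d : nat) (p : nat -> seq nat) : code :=
  fun k => idx [:: 6, d & p k ++ [seq i <- iota 0 k | i \notin p k]].

Definition cst (n : nat) : code := fun=> idx [:: 2; n].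

Definition var (l : nat) : code := permute (idx [:: 3]) (fun k => [:: k - l.+1]).

Definition bind (t : code) (d : nat -> nat) : code := fun k => idx [:: 4; d k.+1; t k].

Definition succ (t : code) : code := bind t (fun=> idx [:: 1]).

(** [u] receives the number [k] of arguments present before the binding, which is the level of the
    new one. *)
Definition let_ (t : code) (u : nat -> code) : code :=
  fun k => idx [:: 4; u k k.+1; t k].

(** S5 places the counter before the previous value, so in the step they have levels [k.+1] and
    [k]. *)
Definition natrec (t0 : code) (t1 : code -> code -> code) (t : code) : code :=
  fun k => idx [:: 4; idx [:: 5; t0 k; t1 (var k.+1) (var k) k.+2]; t k].

Definition call (t : code) (ls : seq nat) : code :=
  bind t (permute (idx [:: 9; size ls])
            (fun k => 0 :: [seq k - l.+1 | l <- ls])).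

Lemma Ev_cst n phi : Ev (cst n) phi n.
Proof. by move=> psi; apply: S2. Qed.

Lemma Ev_var l phi n : lookup phi l = Some (num n) -> Ev (var l) phi n.
Proof.
move=> h psi; have {}h := lookup_cat psi h; have lt := lookup_lt h.
apply: kleene_perm => //=; first by rewrite andbT; lia.
by rewrite (@onth_nth _ (num 0) _ _ _ (lookup_onth h)); apply: S3.
Qed.

Lemma Ev_bind t d phi a b : Ev t phi b ->
  (forall psi, kleene (d (size (psi ++ phi)).+1) (num b :: psi ++ phi) a) ->
  Ev (bind t d) phi a.
Proof. by move=> ht hd psi; apply: S4 (hd _); apply: ht. Qed.

Lemma Ev_succ t phi n : Ev t phi n -> Ev (succ t) phi n.+1.
Proof. by move=> h; apply: Ev_bind h _ => psi; apply: S1. Qed.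

Lemma Ev_let_ t u phi a b : Ev t phi b ->
  (forall psi, Ev (u (size (psi ++ phi))) (num b :: psi ++ phi) a) ->
  Ev (let_ t u) phi a.
Proof. by move=> ht hu psi; apply: S4 (ht psi) _; apply: Ev0 (hu psi). Qed.

Fixpoint iter_nat (a : nat) (f : nat -> nat -> nat) (n : nat) : nat :=
  if n is n'.+1 then f n' (iter_nat a f n') else a.

Lemma Ev_natrec t0 t1 t phi n a f :
  Ev t phi n -> Ev t0 phi a ->
  (forall psi u v m b, Ev u (psi ++ phi) m -> Ev v (psi ++ phi) b ->
     Ev (t1 u v) (psi ++ phi) (f m b)) ->
  Ev (natrec t0 t1 t) phi (iter_nat a f n).
Proof.
move=> ht h0 h1 psi; apply: S4 (ht psi) _.
elim: n {ht} => [|n IHn] /=; first exact/S5_0/h0.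
apply: S5_S IHn _; set b := iter_nat _ _ _.
apply: Ev0 (h1 [:: num n, num b & psi] _ _ _ _ _ _); apply: Ev_var.
  exact: (@lookup_size _ (num b :: psi ++ phi)).
exact/lookup_cons/lookup_size.
Qed.

Lemma Ev_call t ls phi m a :
  Ev t phi m -> uniq ls -> all (fun l => l < size phi) ls ->
  kleene m (args_at phi ls) a -> Ev (call t ls) phi a.
Proof.
move=> ht uls lts hm; apply: Ev_bind ht _ => psi.
set phi' := psi ++ phi; have lts' l : l \in ls -> l < size phi'.
  by move=> /(allP lts) h; rewrite size_cat; lia.
apply: (@kleene_perm _ _ (num m :: phi')).
- rewrite /= map_inj_in_uniq ?uls ?andbT.
    by apply/mapP => -[l /lts']; lia.
  by move=> l l' /lts' ? /lts' ?; lia.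
- by rewrite /=; apply/allP => i /mapP[l _ ->] /=; lia.
rewrite /= -map_comp; apply: S9; first by rewrite size_map.
suff -> : [seq (nth (num 0) (num m :: phi') \o (fun l => (size phi').+1 - l.+1)) i | i <- ls]
   = args_at phi ls by [].
apply/eq_in_map => l ll /=; have l1 := lts' _ ll.
rewrite -(@nth_rev _ (num 0) l (num m :: phi')) ?rev_cons ?nth_rcons ?size_rev ?l1; last by rewrite /=; lia.
by rewrite rev_cat nth_cat size_rev (allP lts).
Qed.

(** Decreasing, because levels are counted from the end: in this order S9 passes on the [k] oldest
    arguments unchanged and forgets the later ones. *)
Definition levels (k : nat) := rev (iota 0 k).

Lemma args_at_levels phi psi : args_at (psi ++ phi) (levels (size phi)) = phi.
Proof.
rewrite /args_at /levels map_rev map_nth_iota0 ?size_rev ?size_cat; last by lia.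
by rewrite rev_cat take_size_cat ?size_rev // revK.
Qed.

Lemma levels_uniq k : uniq (levels k).
Proof. by rewrite rev_uniq iota_uniq. Qed.

Lemma mem_levels k l : (l \in levels k) = (l < k).
Proof. by rewrite mem_rev mem_iota. Qed.

(** The branches are selected before they are run: S5 alone would also run the
    branch that is not taken, which may be undefined. *)
Definition ifc (t u v : code) : code := fun k =>
  call (natrec (cst (v k)) (fun _ _ => cst (u k)) t) (levels k) k.

Lemma kleene_if t u v phi n a : Ev t phi n ->
  (n != 0 -> kleene (u (size phi)) phi a) ->
  (n = 0 -> kleene (v (size phi)) phi a) ->
  kleene (ifc t u v (size phi)) phi a.
Proof.
move=> ht hu hv.
pose m := iter_nat (v (size phi)) (fun _ _ => u (size phi)) n.
have hm : kleene m phi a.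
  by rewrite /m; case: n {ht m} hu hv => [_ /(_ erefl) h|n /(_ isT) h _].
apply: (@Ev0 (call _ (levels (size phi))) phi); apply: (@Ev_call _ _ phi m).
- by apply: Ev_natrec ht _ _ => *; apply: Ev_cst.
- exact: levels_uniq.
- by apply/allP => l; rewrite mem_levels.
by rewrite (@args_at_levels phi [::]).
Qed.

Lemma Ev_if t u v phi n a : Ev t phi n ->
  (n != 0 -> Ev u phi a) -> (n = 0 -> Ev v phi a) -> Ev (ifc t u v) phi a.
Proof.
move=> ht hu hv psi; apply: kleene_if; first exact: EvW ht.
- by move=> /hu.
- by move=> /hv.
Qed.

Definition andc t u := ifc t u (cst 0).
Definition notc t := ifc t (cst 0) (cst 1).
Definition orc t u := ifc t (cst 1) u.

(** The second conjunct is run only if the first holds, so it may contain an oracle call or a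
    recursion that would be undefined otherwise. *)
Lemma Ev_and t u phi (b c : bool) : Ev t phi b -> (b -> Ev u phi c) ->
  Ev (andc t u) phi (b && c).
Proof.
move=> ht hu; apply: Ev_if ht _ _; case: b hu => //= _ _; exact: Ev_cst.
Qed.

Lemma Ev_not t phi (b : bool) : Ev t phi b -> Ev (notc t) phi (~~ b).
Proof. by move=> ht; apply: Ev_if ht _ _; case: b => // _; apply: Ev_cst. Qed.

Lemma Ev_or t u phi (b c : bool) : Ev t phi b -> Ev u phi c ->
  Ev (orc t u) phi (b || c).
Proof.
by move=> ht hu; apply: Ev_if ht _ _; case: b => //= _; apply: Ev_cst.
Qed.

(** Unbounded search; the search procedure receives its own index as an
    argument, which replaces the recursion theorem. *)
Definition mu_index (t : code -> code) (k : nat) : nat :=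
  ifc (t (var k.+1)) (var k.+1)
    (let_ (succ (var k.+1)) (fun=> call (var k) [:: k.+2, k & levels k])) k.+2.

Definition mu (t : code -> code) : code := fun k =>
  idx [:: 4; idx [:: 4; mu_index t k; idx [:: 2; 0]]; idx [:: 2; mu_index t k]].

Definition Ev1 (t : code -> code) (phi : seq input) (f : nat -> nat) :=
  forall psi u n, Ev u (psi ++ phi) n -> Ev (t u) (psi ++ phi) (f n).

Lemma Ev1W psi t phi f : Ev1 t phi f -> Ev1 t (psi ++ phi) f.
Proof. by move=> h psi' u n; rewrite catA; exact: (h _ u n). Qed.

Lemma Ev1_app t phi f u n : Ev1 t phi f -> Ev u phi n -> Ev (t u) phi (f n).
Proof. by move=> h; exact: (h [::] u n). Qed.

Lemma Ev_mu t phi (p : nat -> bool) N :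
  Ev1 t phi p -> p N -> (forall m, p m -> N <= m) -> Ev (mu t) phi N.
Proof.
move=> ht pN leN psi; set phi' := psi ++ phi.
have {}ht : Ev1 t phi' p by exact: Ev1W.
set c := mu_index t (size phi').
apply: S4 (S2 _ _) _; apply: S4 (S2 _ _) _; rewrite -/c.
(* Induction on the distance [d] from the current candidate to the least solution. *)
suff: forall d n, n + d = N -> kleene c [:: num n, num c & phi'] N.
  by move/(_ N 0 (add0n N)).
have hv n : Ev (var (size phi').+1) [:: num n, num c & phi'] n.
  exact/Ev_var/(@lookup_size _ (num c :: phi')).
elim=> [|d IHd] n nd.
  move: nd; rewrite addn0 => ->.
  apply: (@kleene_if _ _ _ [:: num N, num c & phi']).
  - exact: (ht [:: num N; num c] _ _ (hv N)).
  - by move=> _; apply/Ev0/hv.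
  - by rewrite pN.
apply: (@kleene_if _ _ _ [:: num n, num c & phi']).
- exact: (ht [:: num n; num c] _ _ (hv n)).
- by rewrite eqb0 negbK => /leN; rewrite -nd; lia.
move=> _; apply: S4 (Ev0 (Ev_succ (hv n))) _.
(* The self-call selects [n.+1], the index and the original arguments; the old [n] is dropped, which
   restores the shape of the context. *)
pose phi2 := [:: num n.+1, num n, num c & phi'].
apply: (@Ev0 _ phi2); apply: (@Ev_call _ _ phi2 c).
- exact/Ev_var/lookup_cons/lookup_cons/lookup_size.
- by rewrite /= !inE !mem_levels levels_uniq; lia.
- rewrite /phi2 /=; apply/and3P; split; try lia; by apply/allP => l; rewrite mem_levels /=; lia.
rewrite /= [args_at _ _]/= /=.
rewrite (lookup_nth (@lookup_size _ [:: num n, num c & phi'])).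
rewrite (lookup_nth (lookup_cons _ (lookup_cons _ (@lookup_size _ phi')))).
rewrite -/(args_at _ _) (@args_at_levels phi' [:: num n.+1; num n; num c]).
by apply: IHd; rewrite addSnnS.
Qed.

(** * Oracle calls and number quantifiers *)

Fixpoint EvArgs (ds : seq code) (phi : seq input) (s : seq ty) : args s -> Prop :=
  match ds, s return args s -> Prop with
  | [::], [::] => fun _ => True
  | d :: ds', Fn r :: s' => fun a =>
      (forall psi (xi : args r),
        kleene (d (size (psi ++ phi))) (inputs xi ++ psi ++ phi) (app a.1 xi)) /\
      @EvArgs ds' phi s' a.2
  | _, _ => fun _ => False
  end.

Definition oracle (l : nat) (ds : seq code) : code :=
  fun k => idx [:: 8, k - l.+1 & [seq d k | d <- ds]].

Lemma EvArgs_kleenes ds phi s (a : args s) psi : EvArgs ds phi a ->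
  kleenes [seq d (size (psi ++ phi)) | d <- ds] (psi ++ phi) a.
Proof.
elim: ds s a => [|d ds IHds] [|[r] s] //=; first by case=> _; apply: Kl_nil.
by case=> v a /= [hd hds]; apply: Kl_cons => [xi|]; [apply: hd|apply: IHds].
Qed.

Lemma Ev_oracle l ds phi s (F : pfun s) (a : args s) n :
  lookup phi l = Some (Inp F) -> EvArgs ds phi a -> F a = Some n ->
  Ev (oracle l ds) phi n.
Proof.
move=> hl ha Fa psi; have := EvArgs_kleenes psi ha => hk.
exact: S78 (lookup_onth (lookup_cat psi hl)) hk Fa.
Qed.

(** The bound argument comes in front and has level [k]. A number is given to the body as a
    variable; a function, in [lam2], as its level, since it can only be applied. *)
Definition lam1 (t : code -> code) : code := fun k => t (var k) k.+1.
Definition lam2 (B : nat -> code) : code := fun k => B k k.+1.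

Definition EvLam (B : nat -> code) (phi : seq input) (chi : value tN2) :=
  forall psi (h : value tN1),
    Ev (B (size (psi ++ phi))) (total_input h :: psi ++ phi) (chi h).

Lemma EvArgs_num u ds phi s n (a : args s) :
  Ev u phi n -> EvArgs ds phi a ->
  @EvArgs (u :: ds) phi (tN :: s) (n, a).
Proof. by move=> hu ha; split=> // psi xi; apply: hu. Qed.

Lemma EvArgs_lam1 t ds phi s (f : value tN1) (a : args s) :
  Ev1 t phi f -> EvArgs ds phi a ->
  @EvArgs (lam1 t :: ds) phi (tN1 :: s) (f, a).
Proof.
move=> ht ha; split=> // psi [n []].
by apply: Ev0 (ht (num n :: psi) _ _ _); apply/Ev_var/lookup_size.
Qed.

Lemma EvArgs_lam2 B ds phi s (chi : value tN2) (a : args s) :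
  EvLam B phi chi -> EvArgs ds phi a ->
  @EvArgs (lam2 B :: ds) phi (tN2 :: s) (chi, a).
Proof. by move=> hB ha; split=> // psi [h []]; apply: (hB psi h [::]). Qed.

Definition app1 (l : nat) (u : code) : code := oracle l [:: u].
Definition app2 (l : nat) (r : code -> code) : code := oracle l [:: lam1 r].

Lemma Ev1_app1 l phi (f : value tN1) :
  lookup phi l = Some (total_input f) -> Ev1 (app1 l) phi f.
Proof.
move=> hl psi u n hu.
apply: (@Ev_oracle _ _ _ [:: tN] _ (n, tt)); first exact: lookup_cat hl.
  exact: EvArgs_num.
by [].
Qed.

Lemma Ev_app2 l r phi (F : value tN2) f :
  lookup phi l = Some (total_input F) -> Ev1 r phi f -> Ev (app2 l r) phi (F f).
Proof.
move=> hl hr.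
apply: (@Ev_oracle _ _ _ [:: tN1] _ (f, tt)); first exact: hl.
  exact: EvArgs_lam1.
by [].
Qed.

(** Contexts end with the oracle followed by [E2]: in every program level 0 is [E2] and level 1 is
    the oracle. *)
Definition hasE2 (phi : seq input) := lookup phi 0 = Some (total_input E2).

Definition exc (t : code -> code) : code := notc (app2 0 (fun u => notc (t u))).

Lemma Ev_ex t phi (p : nat -> bool) : hasE2 phi -> Ev1 t phi p ->
  Ev (exc t) phi `[< exists n, p n >].
Proof.
move=> h2 ht; pose f : nat -> nat := fun n => ~~ p n.
have hf : Ev1 (fun u => notc (t u)) phi f.
  by move=> psi u n hu; apply/Ev_not/ht.
have := Ev_app2 h2 hf; rewrite /E2.
have -> : (exists n, f n = 0) = (exists n, p n).
  by rewrite propeqE; split=> -[n pn]; exists n; move: pn; rewrite /f; case: (p n).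
case: asboolP => _ h.
  exact: (@Ev_not _ _ false).
exact: (@Ev_not _ _ true).
Qed.

Ltac ev_weaken := match goal with
  | H : ?G |- ?G => exact H
  | |- Ev _ (_ ++ _) _ => apply EvW; ev_weaken
  | |- Ev _ (_ :: _) _ => apply EvC; ev_weaken
  | |- Ev1 _ (_ ++ _) _ => apply Ev1W; ev_weaken
  | |- Ev1 _ (_ :: _) _ => apply (@Ev1W [:: _]); ev_weaken
  | |- hasE2 _ => unfold hasE2 in *; ev_weaken
  | |- lookup (_ ++ _) _ = _ => apply lookup_cat; ev_weaken
  | |- lookup (_ :: _) _ = _ => apply lookup_cons; ev_weaken
  end.

Ltac ev_lemma := fail.

Ltac ev_step := lazymatch goal with
  | |- is_true _ -> _ => let h := fresh in intro h
  | |- hasE2 _ => ev_weaken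
  | |- lookup _ _ = _ => ev_weaken
  | |- Ev (cst _) _ _ => apply Ev_cst
  | |- Ev (succ _) _ _ => apply Ev_succ
  | |- Ev (andc _ _) _ _ => apply Ev_and
  | |- Ev (orc _ _) _ _ => apply Ev_or
  | |- Ev (notc _) _ _ => apply Ev_not
  | |- Ev (exc _) _ _ => apply Ev_ex
  | |- Ev1 (app1 _) _ _ => apply Ev1_app1
  | |- Ev (app2 _ _) _ _ => apply Ev_app2
  | |- Ev ?t _ _ => first [ev_lemma | is_var t; ev_weaken |
      lazymatch t with
      | app1 _ _ => eapply Ev1_app; [apply Ev1_app1; ev_weaken|]
      | ?t1 _ => is_var t1;
        match goal with H : Ev1 t1 _ ?f |- _ =>
          apply (@Ev1_app t1 _ f); [let H' := fresh in pose proof H as H'; ev_weaken |] end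
      end]
  | |- Ev1 ?t _ _ => first [is_var t; ev_weaken | move=> ? ? ? ?]
  end.

Ltac ev := intros; repeat ev_step.

(** * Arithmetic and list codes *)

Definition predc t := natrec (cst 0) (fun u _ => u) t.
Definition addc t u := natrec t (fun _ v => succ v) u.
Definition subc t u := natrec t (fun _ v => predc v) u.
Definition mulc t u := natrec (cst 0) (fun _ v => addc v t) u.
Definition pow2c t := natrec (cst 1) (fun _ v => addc v v) t.

Lemma Ev_pred t phi n : Ev t phi n -> Ev (predc t) phi n.-1.
Proof.
move=> ht; have -> : n.-1 = iter_nat 0 (fun m _ => m) n by case: n {ht}.
by apply: Ev_natrec; ev.
Qed.

Lemma Ev_add t u phi n m : Ev t phi n -> Ev u phi m -> Ev (addc t u) phi (n + m).
Proof.
move=> ht hu; have -> : n + m = iter_nat n (fun _ => S) m.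
  by elim: m {hu} => [|m IHm]; rewrite ?addn0 ?addnS ?IHm.
by apply: Ev_natrec; ev.
Qed.

Lemma Ev_sub t u phi n m : Ev t phi n -> Ev u phi m -> Ev (subc t u) phi (n - m).
Proof.
move=> ht hu; have -> : n - m = iter_nat n (fun _ => predn) m.
  by elim: m {hu} => [|m IHm]; rewrite ?subn0 ?subnS ?IHm.
by apply: Ev_natrec => // *; apply: Ev_pred.
Qed.

Lemma Ev_mul t u phi n m : Ev t phi n -> Ev u phi m -> Ev (mulc t u) phi (n * m).
Proof.
move=> ht hu; have -> : n * m = iter_nat 0 (fun _ b => b + n) m.
  by elim: m {hu} => [|m IHm] /=; rewrite ?muln0 // mulnS IHm addnC.
by apply: Ev_natrec => // [|*]; [apply: Ev_cst|apply: Ev_add; ev].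
Qed.

Lemma Ev_pow2 t phi n : Ev t phi n -> Ev (pow2c t) phi (2 ^ n).
Proof.
move=> ht; have -> : 2 ^ n = iter_nat 1 (fun _ b => b + b) n.
  by elim: n {ht} => [|m IHm] //; rewrite expnS mul2n -addnn IHm.
by apply: Ev_natrec => // [|*]; [apply: Ev_cst|apply: Ev_add; ev].
Qed.

Ltac ev_lemma ::= lazymatch goal with
  | |- Ev (predc _) _ _ => apply Ev_pred
  | |- Ev (addc _ _) _ _ => apply Ev_add
  | |- Ev (subc _ _) _ _ => apply Ev_sub
  | |- Ev (mulc _ _) _ _ => apply Ev_mul
  | |- Ev (pow2c _) _ _ => apply Ev_pow2
  end.

Definition leqc t u := notc (subc t u).
Definition eqc t u := andc (leqc t u) (leqc u t).
Definition ltc t u := leqc (succ t) u.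

Lemma Ev_leq t u phi n m : Ev t phi n -> Ev u phi m -> Ev (leqc t u) phi (n <= m).
Proof.
move=> ht hu; rewrite /leqc; apply: Ev_if; first exact: Ev_sub ht hu.
  by rewrite subn_eq0 => /negPf->; apply: Ev_cst.
by move=> /eqP; rewrite subn_eq0 => ->; apply: Ev_cst.
Qed.

Lemma Ev_lt t u phi n m : Ev t phi n -> Ev u phi m -> Ev (ltc t u) phi (n < m).
Proof. by move=> ht hu; apply: Ev_leq => //; apply: Ev_succ. Qed.

Lemma Ev_eq t u phi n m : Ev t phi n -> Ev u phi m -> Ev (eqc t u) phi (n == m).
Proof.
by move=> ht hu; rewrite eqn_leq; apply: Ev_and => [|_]; apply: Ev_leq.
Qed.

Ltac ev_arith := lazymatch goal with
  | |- Ev (predc _) _ _ => apply Ev_pred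
  | |- Ev (addc _ _) _ _ => apply Ev_add
  | |- Ev (subc _ _) _ _ => apply Ev_sub
  | |- Ev (mulc _ _) _ _ => apply Ev_mul
  | |- Ev (pow2c _) _ _ => apply Ev_pow2
  | |- Ev (leqc _ _) _ _ => apply Ev_leq
  | |- Ev (ltc _ _) _ _ => apply Ev_lt
  | |- Ev (eqc _ _) _ _ => apply Ev_eq
  end.
Ltac ev_lemma ::= ev_arith.

(** A nonzero code is uniquely 2^n (2 m + 1), with head n and tail m. *)
Definition splits t u v := orc (eqc t (cst 0)) (eqc t (mulc (pow2c u) (succ (addc v v)))).
Definition headc t := mu (fun u => exc (fun v => splits t u v)).
Definition tailc t := mu (fun v => exc (fun u => splits t u v)).

Lemma Ev_splits t u v phi c n m : Ev t phi c -> Ev u phi n -> Ev v phi m ->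
  Ev (splits t u v) phi ((c == 0) || (c == 2 ^ n * (m + m).+1)).
Proof. by rewrite /splits; ev. Qed.

Ltac ev_lemma ::= first [ev_arith | lazymatch goal with
  | |- Ev (splits _ _ _) _ _ => apply Ev_splits end].

Lemma pow2_odd_inj n m n' m' :
  2 ^ n * (m + m).+1 = 2 ^ n' * (m' + m').+1 -> n = n' /\ m = m'.
Proof.
rewrite !addnn; elim: n n' => [|n IHn] [|n'].
- by rewrite !mul1n => -[/double_inj].
- by rewrite mul1n expnS -mulnA => /(congr1 odd); rewrite !oddM /= odd_double.
- by rewrite mul1n expnS -mulnA => /(congr1 odd); rewrite !oddM /= odd_double.
- rewrite !expnS -!mulnA => /eqP; rewrite eqn_pmul2l // => /eqP/IHn[-> ->] //.
Qed.

(** The code 0 of the empty list satisfies [splits] for all values, so the least solution is 0: the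
    default of [head], and also the code of an empty tail. *)
Lemma Ev_head t phi c : hasE2 phi -> Ev t phi c ->
  Ev (headc t) phi (head 0 (CodeSeq.decode c)).
Proof.
move=> h2 ht; rewrite -{1}[c]CodeSeq.decodeK in ht.
have hp : Ev1 (fun u => exc (fun v => splits t u v)) phi
    (fun n => `[< exists m, (CodeSeq.code (CodeSeq.decode c) == 0)
      || (CodeSeq.code (CodeSeq.decode c) == 2 ^ n * (m + m).+1) >]).
  by move=> psi u n hu; apply: Ev_ex; ev.
apply: (Ev_mu hp); case: (CodeSeq.decode c) => [|n s] //=.
- by apply/asboolP; exists 0.
- by apply/asboolP; exists (CodeSeq.code s); rewrite addnn eqxx orbT.
move=> m /asboolP[m']; case/orP => /eqP; first by rewrite -addnn; lia.
by rewrite -addnn => /pow2_odd_inj[->].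
Qed.

Lemma Ev_tail t phi c : hasE2 phi -> Ev t phi c ->
  Ev (tailc t) phi (CodeSeq.code (behead (CodeSeq.decode c))).
Proof.
move=> h2 ht; rewrite -{1}[c]CodeSeq.decodeK in ht.
have hp : Ev1 (fun v => exc (fun u => splits t u v)) phi
    (fun m => `[< exists n, (CodeSeq.code (CodeSeq.decode c) == 0)
      || (CodeSeq.code (CodeSeq.decode c) == 2 ^ n * (m + m).+1) >]).
  by move=> psi u n hu; apply: Ev_ex; ev.
apply: (Ev_mu hp); case: (CodeSeq.decode c) => [|n s] //=.
- by apply/asboolP; exists 0.
- by apply/asboolP; exists n; rewrite addnn eqxx orbT.
move=> m /asboolP[m']; case/orP => /eqP; first by rewrite -addnn; lia.
by rewrite -addnn => /pow2_odd_inj[_ ->].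
Qed.

(** * Rational codes and names of reals *)

Definition num1 c := nth 0 (CodeSeq.decode c) 0.
Definition num2 c := nth 0 (CodeSeq.decode c) 1.
Definition den c := nth 0 (CodeSeq.decode c) 2.

Definition num1c t := headc t.
Definition num2c t := headc (tailc t).
Definition denc t := headc (tailc (tailc t)).

Lemma Ev_num1 t phi c : hasE2 phi -> Ev t phi c -> Ev (num1c t) phi (num1 c).
Proof. by move=> h2 ht; rewrite /num1 nth0; apply: Ev_head. Qed.

Lemma Ev_num2 t phi c : hasE2 phi -> Ev t phi c -> Ev (num2c t) phi (num2 c).
Proof.
move=> h2 ht; have := Ev_head h2 (Ev_tail h2 ht).
by rewrite CodeSeq.codeK -nth0 nth_behead.
Qed.

Lemma Ev_den t phi c : hasE2 phi -> Ev t phi c -> Ev (denc t) phi (den c).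
Proof.
move=> h2 ht; have := Ev_head h2 (Ev_tail h2 (Ev_tail h2 ht)).
by rewrite !CodeSeq.codeK -nth0 !nth_behead.
Qed.

Definition consc t u := mulc (pow2c t) (succ (addc u u)).
Definition ratc t u v := consc t (consc u (consc v (cst 0))).

Lemma Ev_cons t u phi n s : Ev t phi n -> Ev u phi (CodeSeq.code s) ->
  Ev (consc t u) phi (CodeSeq.code (n :: s)).
Proof.
move=> ht hu; rewrite /= -addnn; apply: Ev_mul; first exact: Ev_pow2.
exact/Ev_succ/Ev_add.
Qed.

Lemma Ev_rat t u v phi i j k : Ev t phi i -> Ev u phi j -> Ev v phi k ->
  Ev (ratc t u v) phi (CodeSeq.code [:: i; j; k]).
Proof. by move=> *; do 3 apply: Ev_cons => //; apply: Ev_cst. Qed.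

Definition ltq c d := (rat_of_code c < rat_of_code d)%R.
(** On rationals [shup c m] is c + 2^-m, and [unq i c] is 2^(i+1) c - 1, the inverse of the [i]-th
    copy map; stored denominators are one less than the true ones. *)
Definition shup c m := CodeSeq.code
  [:: num1 c * 2 ^ m + (den c).+1; num2 c * 2 ^ m; ((den c).+1 * 2 ^ m).-1].
Definition unq i c := CodeSeq.code
  [:: 2 ^ i.+1 * num1 c; 2 ^ i.+1 * num2 c + (den c).+1; den c].

Definition ltqc t u :=
  ltc (addc (mulc (num1c t) (succ (denc u))) (mulc (num2c u) (succ (denc t))))
      (addc (mulc (num1c u) (succ (denc t))) (mulc (num2c t) (succ (denc u)))).
Definition shupc t u :=
  ratc (addc (mulc (num1c t) (pow2c u)) (succ (denc t)))
       (mulc (num2c t) (pow2c u)) (predc (mulc (succ (denc t)) (pow2c u))).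
Definition unqc u t :=
  ratc (mulc (pow2c (succ u)) (num1c t))
       (addc (mulc (pow2c (succ u)) (num2c t)) (succ (denc t))) (denc t).

Local Open Scope ring_scope.

Lemma rat_codeE c : rat_of_code c = ((num1 c)%:R - (num2 c)%:R) / (den c).+1%:R.
Proof. by []. Qed.

Lemma rat_code3 i j k :
  rat_of_code (CodeSeq.code [:: i; j; k]) = (i%:R - j%:R) / k.+1%:R.
Proof. by rewrite /rat_of_code CodeSeq.codeK. Qed.

Lemma ltqE c d : ltq c d =
  (num1 c * (den d).+1 + num2 d * (den c).+1 <
   num1 d * (den c).+1 + num2 c * (den d).+1)%N.
Proof.
rewrite /ltq !rat_codeE ltr_pdivrMr ?ltr0Sn // mulrAC ltr_pdivlMr ?ltr0Sn //.
rewrite -(@ltr_nat rat) !natrD !natrM; apply/idP/idP; lra.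
Qed.

Lemma shupE c m : rat_of_code (shup c m) = rat_of_code c + 2 ^- m.
Proof.
rewrite rat_code3 rat_codeE prednK ?muln_gt0 ?expn_gt0 //.
rewrite natrD !natrM !natrX; field.
by rewrite addrC natr1 pnatr_eq0 expf_neq0.
Qed.

Lemma unqE i c : rat_of_code (unq i c) = 2 ^+ i.+1 * rat_of_code c - 1.
Proof.
rewrite rat_code3 rat_codeE.
rewrite natrD !natrM !natrX; field.
by rewrite addrC natr1 pnatr_eq0.
Qed.

Lemma rat_of_code_onto q : exists c, rat_of_code c = q.
Proof.
exists (CodeSeq.code (match numq q with
  | Posz n => [:: n; 0; (absz (denq q)).-1]
  | Negz n => [:: 0; n.+1; (absz (denq q)).-1] end)%N).
rewrite -[RHS]divq_num_den; have := denq_gt0 q; have := absz_denq q.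
case: (absz (denq q)) => [<-|d <- _] //.
by case: (numq q) => n; rewrite rat_code3 ?subr0 ?sub0r //= ?NegzE ?mulrNz.
Qed.

Local Open Scope nat_scope.

Lemma Ev_ltq t u phi c d : hasE2 phi -> Ev t phi c -> Ev u phi d ->
  Ev (ltqc t u) phi (ltq c d).
Proof.
move=> h2 ht hu; rewrite ltqE.
by apply: Ev_lt; apply: Ev_add; apply: Ev_mul;
  try apply: Ev_succ; try apply: Ev_num1; try apply: Ev_num2; try apply: Ev_den.
Qed.

Lemma Ev_shup t u phi c m : hasE2 phi -> Ev t phi c -> Ev u phi m ->
  Ev (shupc t u) phi (shup c m).
Proof.
move=> h2 ht hu; apply: Ev_rat.
- by do ![apply: Ev_add|apply: Ev_mul|apply: Ev_succ|apply: Ev_num1|apply: Ev_den|apply: Ev_pow2].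
- by do ![apply: Ev_mul|apply: Ev_num2|apply: Ev_pow2].
- by do ![apply: Ev_pred|apply: Ev_mul|apply: Ev_succ|apply: Ev_den|apply: Ev_pow2].
Qed.

Lemma Ev_unq t u phi c i : hasE2 phi -> Ev u phi i -> Ev t phi c ->
  Ev (unqc u t) phi (unq i c).
Proof.
move=> h2 hu ht; apply: Ev_rat.
- by do ![apply: Ev_mul|apply: Ev_succ|apply: Ev_num1|apply: Ev_pow2].
- by do ![apply: Ev_add|apply: Ev_mul|apply: Ev_succ|apply: Ev_num2|apply: Ev_den|apply: Ev_pow2].
- exact: Ev_den.
Qed.

Ltac ev_rat := lazymatch goal with
  | |- Ev (ltqc _ _) _ _ => apply Ev_ltq
  | |- Ev (shupc _ _) _ _ => apply Ev_shup
  | |- Ev (unqc _ _) _ _ => apply Ev_unq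
  end.
Ltac ev_lemma ::= first [ev_rat | ev_arith].

Definition realc := code -> code.

Definition gtc (r : realc) (t : code) := exc (fun u => ltqc (shupc t u) (r u)).
Definition ltrc (r s : realc) := exc (fun u => andc (notc (gtc r u)) (gtc s u)).
Definition close_c (r : realc) u v :=
  andc (ltqc (r u) (shupc (r v) u)) (ltqc (r v) (shupc (r u) u)).
Definition isnamec (r : realc) :=
  notc (exc (fun u => exc (fun v => notc (close_c r u (addc u v))))).
Definition code1 := CodeSeq.code [:: 1].
Definition in01c (r : realc) :=
  andc (notc (ltrc r (fun=> cst 0))) (notc (ltrc (fun=> cst code1) r)).
Definition memc (l : nat) (r : realc) :=
  andc (isnamec r) (andc (in01c r) (eqc (app2 l r) (cst 1))).

Definition gtb (f : nat -> nat) c := `[< exists n, ltq (shup c n) (f n) >].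
Definition ltRb f g := `[< exists c, ~~ gtb f c && gtb g c >].
Definition closeb (f : nat -> nat) n m :=
  ltq (f n) (shup (f m) n) && ltq (f m) (shup (f n) n).
Definition isnameb f := ~~ `[< exists n, `[< exists i, ~~ closeb f n (n + i) >] >].
Definition in01b f := ~~ ltRb f (fun=> 0) && ~~ ltRb (fun=> code1) f.
(** A characteristic function is unconstrained outside the names of points of [0,1]. The first two
    tests remove this freedom, so the result depends on the carrier alone. *)
Definition memb (F : value tN2) f := [&& isnameb f, in01b f & F f == 1].

Lemma Ev_gt r t phi f c : hasE2 phi -> Ev1 r phi f -> Ev t phi c ->
  Ev (gtc r t) phi (gtb f c).
Proof. by rewrite /gtc; ev. Qed.

Ltac ev_gt := first [lazymatch goal with
  | |- Ev (gtc _ _) _ _ => apply Ev_gt end | ev_rat | ev_arith].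
Ltac ev_lemma ::= ev_gt.

Lemma Ev_ltr r s phi f g : hasE2 phi -> Ev1 r phi f -> Ev1 s phi g ->
  Ev (ltrc r s) phi (ltRb f g).
Proof. by rewrite /ltrc; ev. Qed.

Lemma Ev_isname r phi f : hasE2 phi -> Ev1 r phi f -> Ev (isnamec r) phi (isnameb f).
Proof. by rewrite /isnamec /close_c; ev. Qed.

Lemma Ev_in01 r phi f : hasE2 phi -> Ev1 r phi f -> Ev (in01c r) phi (in01b f).
Proof. by move=> h2 hr; apply: Ev_and => [|_]; apply/Ev_not/Ev_ltr; ev. Qed.

Lemma Ev_mem l r phi F f : hasE2 phi -> lookup phi l = Some (total_input F) ->
  Ev1 r phi f -> Ev (memc l r) phi (memb F f).
Proof.
move=> h2 hl hr; apply: Ev_and => [|_]; first exact: Ev_isname.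
by apply: Ev_and => [|_]; [apply: Ev_in01|apply: Ev_eq; ev].
Qed.

Local Open Scope classical_set_scope.
Local Open Scope ring_scope.

(** * Reals and their canonical names *)

Section Names.
Variable R : realType.
Implicit Types (x y : R) (f g : nat -> nat) (S : set R).

Definition val_code c : R := ratr (rat_of_code c).

Lemma ltq_val c d : ltq c d = (val_code c < val_code d).
Proof. by rewrite /val_code ltr_rat. Qed.

Lemma val_shup c m : val_code (shup c m) = val_code c + 2 ^- m.
Proof. by rewrite /val_code shupE rmorphD /= fmorphV rmorphXn /= ratr_nat. Qed.

Lemma val_unq i c : val_code (unq i c) = 2 ^+ i.+1 * val_code c - 1.
Proof. by rewrite /val_code unqE rmorphB rmorphM rmorphXn /= ratr_nat rmorph1. Qed.

Lemma val_code_dense x y : x < y -> exists2 c, x < val_code c & val_code c < y.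
Proof.
move=> xy; have [q] := rat_in_itvoo xy; rewrite in_itv /= => /andP[xq qy].
by have [c hc] := rat_of_code_onto q; exists c; rewrite /val_code hc.
Qed.

Lemma val_code0 : val_code 0 = 0.
Proof. by rewrite /val_code /rat_of_code /= subrr mul0r rmorph0. Qed.

Lemma val_code1 : val_code code1 = 1.
Proof.
by rewrite /val_code /rat_of_code CodeSeq.codeK /= subr0 divr1 rmorph1.
Qed.

Lemma pow2V_gt0 n : 0 < 2 ^- n :> R.
Proof. by rewrite invr_gt0 exprn_gt0. Qed.

Lemma pow2V_small x : 0 < x -> exists n, 2 ^- n < x.
Proof.
move=> x0; pose n := Num.truncn x^-1; exists n.
rewrite invf_plt ?posrE ?exprn_gt0 //.
apply: lt_le_trans (truncnS_gt _) _.
by rewrite -natrX ler_nat ltn_expl.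
Qed.

Lemma names_close f x n i : names f x ->
  `|val_code (f n) - val_code (f (n + i)%N)| < 2 ^- n.
Proof.
move=> [h _]; rewrite /val_code -rmorphB -ratr_norm.
rewrite (_ : 2 ^- n = ratr (2 ^- n)); first by rewrite ltr_rat.
by rewrite fmorphV rmorphXn /= ratr_nat.
Qed.

Lemma names_dist f x n : names f x -> `|val_code (f n) - x| <= 2 ^- n.
Proof.
move=> hf; have [_ hl] := hf.
apply: (@cvgr_to_le _ \oo _ _ (fun i => `|val_code (f n) - val_code (f i)|)).
  by apply: cvg_norm; apply: cvgB; [exact: cvg_cst|exact: hl].
exists n => // m /= nm; apply/ltW.
by rewrite -(subnKC nm); apply: names_close hf.
Qed.

Lemma names_intro f x :
  (forall n i, `|val_code (f n) - val_code (f (n + i)%N)| < 2 ^- n) ->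
  (forall n, `|val_code (f n) - x| <= 2 ^- n) -> names f x.
Proof.
move=> hc hd; split=> [n i|].
  rewrite -(ltr_rat R) ratr_norm rmorphB /= fmorphV rmorphXn /= ratr_nat.
  exact: hc.
apply/cvgrPdist_lt => e e0; have [n0 hn0] := pow2V_small e0.
exists n0 => // n /= n0n; rewrite distrC; apply: le_lt_trans (hd n) _.
apply: le_lt_trans hn0; rewrite lef_pV2 ?posrE ?exprn_gt0 //.
by rewrite ler_eXn2l // ltr1n.
Qed.

Lemma names_unique f x y : names f x -> names f y -> x = y.
Proof.
move=> [_ hx] [_ hy]; exact: (@cvg_unique _ (@Rhausdorff R) _ _ _ _ hx hy).
Qed.

Lemma gtP f x c : names f x -> gtb f c = (val_code c < x).
Proof.
move=> hf; apply/asboolP/idP => [[n]|cx].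
  rewrite ltq_val val_shup => h; have := names_dist n hf.
  rewrite ler_norml => /andP[_]; lra.
(* One half of the distance pays for the shift by 2^-n, the other for the error of entry [n]. *)
have [n hn] : exists n, 2 ^- n < (x - val_code c) / 2.
  by apply: pow2V_small; lra.
exists n; rewrite ltq_val val_shup; have := names_dist n hf.
by rewrite ler_norml => /andP[]; lra.
Qed.

Lemma ltRP f g x y : names f x -> names g y -> ltRb f g = (x < y).
Proof.
move=> hf hg; apply/asboolP/idP => [[c]|xy].
  by rewrite (gtP _ hf) (gtP _ hg) -leNgt => /andP[]; apply: le_lt_trans.
have [c xc cy] := val_code_dense xy; exists c.
by rewrite (gtP _ hf) (gtP _ hg) -leNgt ltW.
Qed.

Lemma names_cst c : names (fun=> c) (val_code c).
Proof. by apply: names_intro => *; rewrite subrr normr0 ?ltW ?pow2V_gt0. Qed.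

Lemma in01P f x : names f x -> in01b f = `[< I01 x >].
Proof.
move=> hf; rewrite /in01b (ltRP hf (names_cst 0)) (ltRP (names_cst code1) hf).
rewrite val_code0 val_code1 -!leNgt.
by apply/idP/asboolP.
Qed.

Lemma isnameP f : isnameb f <-> exists x, names f x.
Proof.
split.
  move/asboolPn => h.
  have hc n i : `|val_code (f n) - val_code (f (n + i)%N)| < 2 ^- n.
    have : closeb f n (n + i).
      by apply: contrapT => /negP h'; apply: h; exists n; apply/asboolP; exists i.
    rewrite /closeb !ltq_val !val_shup ltr_norml => /andP[]; lra.
  have : cvg ((fun n => val_code (f n)) @ \oo).
    apply/cauchy_cvgP/cauchyP => e e0; have [n0 hn0] := pow2V_small e0.
    exists (val_code (f n0)); exists n0 => // n /= n0n.
    apply: lt_trans hn0; rewrite -(subnKC n0n); exact: hc.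
  move=> /cvg_ex[x hx]; exists x; split=> // n i.
  rewrite -(ltr_rat R) ratr_norm rmorphB /= fmorphV rmorphXn /= ratr_nat.
  exact: hc.
move=> [x hx]; apply/asboolPn => -[n /asboolP[i]]; apply/negP; rewrite negbK.
rewrite /closeb !ltq_val !val_shup; have := names_close n i hx.
by rewrite ltr_norml => /andP[]; lra.
Qed.

Definition chi S : value tN2 := fun f => `[< exists2 x, S x & names f x >].

Lemma chi_names S f x : names f x -> chi S f = `[< S x >].
Proof.
move=> hf; rewrite /chi; congr (nat_of_bool _); apply/asboolP/asboolP => [[y Sy hy]|Sx].
  by rewrite (names_unique hf hy).
by exists x.
Qed.

Lemma charfun_chi S : charfun01 R (chi S).
Proof.
split=> [x f g _ hf hg|x f _ hf]; first by rewrite !(chi_names _ hf) !(chi_names _ hg).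
by rewrite /chi; case: asboolP; [right|left].
Qed.

(** The one-sided form makes the entries computable from questions c < x: the lower bound is such a
    question, and the upper bound is the negation of one, at c + 2^-(n+1). *)
Lemma names_approx f x :
  (forall n, val_code (f n) < x <= val_code (f n) + 2 ^- n.+1) -> names f x.
Proof.
move=> h; have e n : 2 ^- n.+1 = 2 ^- n / 2 :> R by rewrite exprSr invfM.
apply: names_intro => [n i|n]; last first.
  by have := h n; have := pow2V_gt0 n; rewrite e ler_norml; lra.
have le : 2 ^- (n + i)%N <= 2 ^- n :> R.
  by rewrite lef_pV2 ?posrE ?exprn_gt0 // ler_eXn2l ?ltr1n // leq_addr.
have := h n; have := h (n + i)%N; have := pow2V_gt0 n.
by rewrite !e ltr_norml; lra.
Qed.

Definition least (p : nat -> bool) :=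
  if pselect (exists n, p n) is left e then ex_minn e else 0%N.

Lemma leastP (p : nat -> bool) : (exists n, p n) ->
  p (least p) /\ forall m, p m -> (least p <= m)%N.
Proof. by rewrite /least; case: pselect => // e _; case: ex_minnP. Qed.

(** The minimal choice of the entries makes this name depend on [x] only. *)
Definition name_of x : nat -> nat :=
  fun n => least (fun c => val_code c < x <= val_code c + 2 ^- n.+1).

Lemma name_of_ex x n :
  exists c, val_code c < x <= val_code c + 2 ^- n.+1.
Proof.
have [|c h1 h2] := @val_code_dense (x - 2 ^- n.+1) x.
  by have := pow2V_gt0 n.+1; lra.
by exists c; lra.
Qed.

Lemma names_name_of x : names (name_of x) x.
Proof. by apply: names_approx => n; have [] := leastP (name_of_ex x n). Qed.

Lemma carrier_chi S : S `<=` @I01 R -> carrier R (chi S) = S.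
Proof.
move=> S01; apply/seteqP; split=> x /=.
  by move=> [_ [f hf]]; rewrite (chi_names _ hf); case: asboolP.
move=> Sx; split; first exact: S01.
have hf := names_name_of x; exists (name_of x) => //.
by rewrite (chi_names _ hf); case: asboolP.
Qed.

Lemma memP F f : charfun01 R F -> memb F f = chi (carrier R F) f :> nat.
Proof.
move=> [hF _]; rewrite /chi; congr (nat_of_bool _); apply/idP/asboolP.
  case/and3P => /isnameP[x hx]; rewrite (in01P hx) => /asboolP x01 /eqP Ff.
  by exists x => //; split=> //; exists f.
move=> [x [x01 [g hg Fg]] hf]; apply/and3P; split.
- by apply/isnameP; exists x.
- by rewrite (in01P hf); apply/asboolP.
- by rewrite (hF _ _ _ x01 hf hg) Fg.
Qed.
End Names.

(** * Sets of reals as oracle arguments, and their scaled copies *)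

Section Sets.
Variable R : realType.
Implicit Types (x y : R) (f g : nat -> nat) (S Z : set R).

Definition name_ofc (T : code -> code) : realc :=
  fun u => mu (fun c => andc (T c) (notc (T (shupc c (succ u))))).

Lemma Ev_name_of T phi x : hasE2 phi -> Ev1 T phi (fun c => val_code R c < x) ->
  Ev1 (name_ofc T) phi (name_of x).
Proof.
move=> h2 hT psi u n hu; have [h1 h3] := leastP (name_of_ex x n).
have hp : Ev1 (fun c => andc (T c) (notc (T (shupc c (succ u))))) (psi ++ phi)
    (fun c => val_code R c < x <= val_code R c + 2 ^- n.+1).
  move=> psi' v c hv; rewrite [_ <= _]leNgt -val_shup.
  apply: Ev_and => [|_]; first by ev.
  apply: Ev_not; pose k c : nat := val_code R c < x.
  by apply: (@Ev1_app _ _ k); rewrite /k; ev.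
exact: Ev_mu hp h1 h3.
Qed.

(** A value is required on all sequences, because oracle arguments are total. [EvP] requires one on
    names only and is used behind a membership test. *)
Definition EvS (B : realc -> code) phi S :=
  forall psi r f, Ev1 r (psi ++ phi) f -> Ev (B r) (psi ++ phi) (chi S f).

Definition EvP (C : realc -> code) phi (P : set R) :=
  forall psi r f x, Ev1 r (psi ++ phi) f -> names f x ->
    Ev (C r) (psi ++ phi) `[< P x >].

Lemma EvSW psi B phi S : EvS B phi S -> EvS B (psi ++ phi) S.
Proof. by move=> h psi' r f; rewrite catA; exact: (h _ r f). Qed.

Lemma EvPW psi C phi P : EvP C phi P -> EvP C (psi ++ phi) P.
Proof. by move=> h psi' r f x; rewrite catA; exact: (h _ r f x). Qed.

Lemma EvS_app B phi S r f : EvS B phi S -> Ev1 r phi f -> Ev (B r) phi (chi S f).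
Proof. by move=> h; exact: (h [::] r f). Qed.

Lemma EvS_lam B phi S : EvS B phi S -> EvLam (fun l => B (app1 l)) phi (chi S).
Proof.
move=> h psi g; apply: (h (total_input g :: psi)).
exact/Ev1_app1/lookup_size.
Qed.

Lemma EvS_and B C phi S P : EvS B phi S -> EvP C phi P ->
  EvS (fun r => andc (B r) (C r)) phi (S `&` P).
Proof.
move=> hB hC psi r f hr; rewrite /chi.
have -> : `[< exists2 x, (S `&` P) x & names f x >] =
    `[< exists2 x, S x & names f x >] && `[< exists2 x, P x & names f x >].
  apply/asboolP/andP => [[x [Sx Px] hf]|[/asboolP[x Sx hf] /asboolP[y Py hy]]].
    by split; apply/asboolP; exists x.
  by exists x => //; split=> //; rewrite (names_unique hf hy).
apply: Ev_and; first exact: hB.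
case/asboolP => x _ hf; have := hC _ _ _ _ hr hf.
by have := chi_names P hf; rewrite /chi => ->.
Qed.

Lemma EvS_mem l phi F : hasE2 phi -> lookup phi l = Some (total_input F) ->
  charfun01 R F -> EvS (memc l) phi (carrier R F).
Proof.
move=> h2 hl hF psi r f hr; rewrite -(memP _ hF).
by apply: Ev_mem hr; ev.
Qed.

Lemma EvP_gt t phi c : hasE2 phi -> Ev t phi c ->
  EvP (gtc^~ t) phi [set x | val_code R c < x].
Proof.
move=> h2 ht psi r f x hr hf /=; rewrite asboolb -(gtP _ hf).
by apply: Ev_gt => //; ev.
Qed.

Lemma EvP_not C phi P : EvP C phi P -> EvP (fun r => notc (C r)) phi (~` P).
Proof.
move=> h psi r f x hr hf; rewrite asbool_neg; apply: Ev_not; exact: h hr hf.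
Qed.

Definition entryc (g : realc) (i : code) : realc :=
  fun m => g (succ (addc (mulc m (g (cst 0))) i)).

Lemma Ev1_entry (g : realc) i phi f n : Ev1 g phi f -> Ev i phi n ->
  Ev1 (entryc g i) phi (entry f n).
Proof. by move=> hg hi; rewrite /entryc /entry; ev. Qed.

Definition foundc (g : realc) (C : realc -> code) : code :=
  exc (fun i => andc (ltc i (g (cst 0))) (C (entryc g i))).

Lemma Ev_found (g : realc) C phi f Z S : hasE2 phi -> Ev1 g phi f -> fin_includes f Z ->
  EvS C phi S -> (S !=set0 -> (S `&` Z) !=set0) ->
  Ev (foundc g C) phi `[< S !=set0 >].
Proof.
move=> h2 hg [_ fZ] hC SZ.
have -> : `[< S !=set0 >] =
    `[< exists i, (i < f 0)%N && `[< exists2 x, S x & names (entry f i) x >] >].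
  apply/asboolP/asboolP => [/SZ[x [Sx /fZ[i lti hi]]]|[i /andP[_ /asboolP[x Sx _]]]].
    by exists i; rewrite lti /=; apply/asboolP; exists x.
  by exists x.
apply: Ev_ex => // psi u i hu; apply: Ev_and => [|_]; first by ev; exact: Ev_cst.
by apply: hC; apply: Ev1_entry => //; ev.
Qed.

Definition omc (B : nat -> code) : realc := fun u => oracle 1 [:: lam2 B; u].

Lemma EvLamW psi B phi h : EvLam B phi h -> EvLam B (psi ++ phi) h.
Proof. by move=> hB psi'; rewrite catA; exact: hB. Qed.

Lemma omega_value D w Z : Omega_on D w -> Z `<=` @I01 R -> D Z ->
  exists2 g : value tN1, fin_includes g Z & forall n, w (chi Z, (n, tt)) = Some (g n).
Proof.
move=> hw Z01 DZ; have [+ _] := hw (chi Z, tt); case.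
  by split; [exact: charfun_chi | rewrite /= carrier_chi].
move=> g; rewrite /= carrier_chi // => hg wg.
by exists g => // n; apply: (wg (n, tt)).
Qed.

Lemma Ev1_omc B phi (w : pfun [:: tN2; tN]) chi g : lookup phi 1 = Some (Inp w) ->
  EvLam B phi chi -> (forall n, w (chi, (n, tt)) = Some (g n)) ->
  Ev1 (omc B) phi g.
Proof.
move=> hl hB wg psi u n hu.
apply: (@Ev_oracle 1 [:: lam2 B; u] _ [:: tN2; tN] w (chi, (n, tt))).
- exact: lookup_cat hl.
- by apply: EvArgs_lam2; [exact: EvLamW|exact: EvArgs_num].
- by rewrite wg.
Qed.

(** [S] is the set in question and [Z] the one submitted: [Z] must be in the domain in any case, but
    contain a point of [S] only if there is one. *)
Lemma Ev_omega D w B C phi Z S : Omega_on D w -> hasE2 phi ->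
  lookup phi 1 = Some (Inp w) -> EvLam B phi (chi Z) -> Z `<=` @I01 R -> D Z ->
  EvS C phi S -> (S !=set0 -> (S `&` Z) !=set0) ->
  Ev (foundc (omc B) C) phi `[< S !=set0 >].
Proof.
move=> hw h2 hl hB Z01 DZ hC SZ; have [g hg wg] := omega_value hw Z01 DZ.
exact: Ev_found (Ev1_omc hl hB wg) hg hC SZ.
Qed.

(** The [i]-th copy of [x] is (1 + x) / 2^(i+1), so that [i] can be any number. *)
Definition copies (K : nat -> bool) S : set R :=
  [set y | exists i, K i /\ S (2 ^+ i.+1 * y - 1)].

(** Multiplication by 2^(i+1) enlarges errors; reading [i.+1] entries further compensates for it. *)
Definition unqf i f : nat -> nat := fun m => unq i (f (m + i.+1)%N).
Definition unqr (i : code) (r : realc) : realc := fun u => unqc i (r (addc u (succ i))).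

Lemma Ev1_unqr i r phi n f : hasE2 phi -> Ev i phi n -> Ev1 r phi f ->
  Ev1 (unqr i r) phi (unqf n f).
Proof. by move=> h2 hi hr; rewrite /unqr /unqf; ev. Qed.

Lemma names_unqf i f y : names f y -> names (unqf i f) (2 ^+ i.+1 * y - 1).
Proof.
move=> hf.
have p0 : 0 < 2 ^+ i.+1 :> R by rewrite exprn_gt0.
have e n : 2 ^- n = 2 ^+ i.+1 * 2 ^- (n + i.+1) :> R.
  by rewrite exprD invfM mulrCA mulfV ?mulr1 // gt_eqF.
apply: names_intro => [n j|n]; rewrite /unqf !val_unq.
  have := names_close (n + i.+1) j hf.
  rewrite (e n) -(ltr_pM2l p0) -{1}(gtr0_norm p0) -normrM.
  by rewrite addnAC; congr (`|_| < _); ring.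
have := names_dist (n + i.+1) hf.
rewrite (e n) -(ler_pM2l p0) -{1}(gtr0_norm p0) -normrM.
by congr (`|_| <= _); ring.
Qed.

Lemma copies_I01 K S : S `<=` @I01 R -> copies K S `<=` @I01 R.
Proof.
move=> S01 y /= [i [_ /S01]]; rewrite /I01 /=.
have p1 : 2 <= 2 ^+ i.+1 :> R.
  by rewrite exprS ler_peMr // exprn_ege1 // ler1n.
nra.
Qed.

(** [isnamec] is tested separately: [unqf i f] skips the first entries of [f], so it can be a name
    when [f] is not. *)
Definition copiesc (K : code -> code) (B : realc -> code) (r : realc) : code :=
  andc (isnamec r) (exc (fun i => andc (K i) (B (unqr i r)))).

Lemma EvS_copies K B phi k S : hasE2 phi -> Ev1 K phi (k : nat -> bool) ->
  EvS B phi S -> EvS (copiesc K B) phi (copies k S).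
Proof.
move=> h2 hK hB psi r f hr; rewrite /chi.
have -> : `[< exists2 x, copies k S x & names f x >] =
    isnameb f && `[< exists i, k i && `[< exists2 x, S x & names (unqf i f) x >] >].
  apply/asboolP/andP => [[y [i [ki Sy]] hf]|[/(isnameP R)[y hf] /asboolP[i /andP[ki]]]].
    split; first by apply/(isnameP R); exists y.
    apply/asboolP; exists i; rewrite ki /=; apply/asboolP.
    by exists (2 ^+ i.+1 * y - 1) => //; exact: names_unqf.
  move=> /asboolP[x Sx hx]; exists y => //; exists i; split=> //.
  by rewrite (names_unique (names_unqf i hf) hx).
apply: Ev_and => [|_]; first by apply: Ev_isname => //; ev.
apply: Ev_ex => [|psi' u i hu]; first by ev.
apply: Ev_and => [|_]; first by ev.
rewrite catA; apply: hB; rewrite -catA.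
by apply: Ev1_unqr => //; ev.
Qed.
End Sets.

Local Open Scope card_scope.

(** * Computing an element of Omega or Omega_1 from the other functionals *)

Fixpoint const_value (s : seq ty) : value (Fn s) :=
  match s with [::] => 0%N | _ :: s' => fun _ => const_value s' end.

Fixpoint take_args (s t : seq ty) : args (s ++ t) -> args s :=
  match s with
  | [::] => fun _ => tt
  | u :: s' => fun a => (a.1, @take_args s' t a.2)
  end.

Fixpoint drop_args (s t : seq ty) : args (s ++ t) -> args t :=
  match s with
  | [::] => fun a => a
  | u :: s' => fun a => @drop_args s' t a.2
  end.

Lemma acatE s t (a : args (s ++ t)) : a = acat (take_args a) (drop_args a).
Proof. by elim: s a => [//|u s IHs] [v a] /=; rewrite -IHs. Qed.

Lemma take_acat s t (a : args s) (b : args t) : take_args (acat a b) = a.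
Proof. by elim: s a => [[] //|u s IHs] [v a] /=; rewrite IHs. Qed.

Lemma drop_acat s t (a : args s) (b : args t) : drop_args (acat a b) = b.
Proof. by elim: s a => [[] //|u s IHs] [v a] /=; rewrite IHs. Qed.

Lemma size_inputs s (a : args s) : size (inputs a) = size s.
Proof. by elim: s a => [|u s IHs] //= [v a] /=; rewrite IHs. Qed.

Definition restrict s t (P : args s -> Prop) (v : args s -> value (Fn t)) :
    pfun (s ++ t) := fun x =>
  if `[< P (take_args x) >] then Some (app (v (take_args x)) (drop_args x)) else None.

Lemma restrict_described s t (P : args s -> Prop) Q (v : args s -> value (Fn t)) :
  (forall a, P a -> Q a (v a)) -> described P Q (restrict P v).
Proof.
move=> PQ a; split=> [Pa|nPa]; rewrite /restrict.
  exists (v a); first exact: PQ.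
  by move=> b; rewrite take_acat drop_acat; case: asboolP.
by move=> b; rewrite take_acat; case: asboolP.
Qed.

Lemma restrict_computable s t (P : args s -> Prop) (v : args s -> value (Fn t))
    c phi :
  (forall a, P a -> forall b, Ev c (inputs (acat a b) ++ phi) (app (v a) b)) ->
  computable_in (restrict P v) phi.
Proof.
move=> h; exists (c (size (s ++ t) + size phi)%N) => x n; rewrite /restrict.
case: asboolP => // Px [<-]; have := Ev0 (h _ Px (drop_args x)).
by rewrite -acatE [size (_ ++ phi)]size_cat size_inputs.
Qed.

Definition ctx s (a : args s) u (w : pfun u) := inputs a ++ [:: Inp w; total_input E2].

(** The output [v] depends on the input only, so the single functional [restrict P v] is computable
    from every [w]. In the other direction [g] may vary with [F], since each [F] has to compute just
    some element. *)
Lemma class_in_cluster_canonical s0 t0 P0 (Q0 : args s0 -> value (Fn t0) -> Prop)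
    s t P (Q : args s -> value (Fn t) -> Prop) (v : args s -> value (Fn t)) :
  (forall F, described P Q F -> exists c, forall a, P0 a ->
     exists2 g, Q0 a g & forall b, Ev c (ctx (acat a b) F) (app g b)) ->
  (forall a, P a -> Q a (v a)) ->
  (forall w, described P0 Q0 w -> exists c, forall a, P a ->
     forall b, Ev c (ctx (acat a b) w) (app (v a) b)) ->
  class_in_cluster (described P0 Q0) (described P Q).
Proof.
move=> h1 PQ h2.
have H1 F : described P Q F ->
    exists2 w, described P0 Q0 w & computable_in w [:: Inp F; total_input E2].
  move=> /h1[c hc].
  (* Choice collects the outputs into one functional; outside [P0] any value serves, as the
     restriction is undefined there. *)
  have : forall a, exists g, P0 a -> Q0 a g /\ forall b, Ev c (ctx (acat a b) F) (app g b).
    move=> a; have [/hc[g Qg hg]|nPa] := pselect (P0 a); first by exists g.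
    by exists (const_value t0).
  move=> /choice[g hg]; exists (restrict P0 g).
    by apply: restrict_described => a /hg[].
  by apply: (@restrict_computable _ _ _ _ c) => a /hg[].
split=> //; exists (restrict P v); first exact: restrict_described.
split=> [w /h2[c hc]|]; first exact: (@restrict_computable _ _ _ _ c).
by apply: H1; apply: restrict_described.
Qed.

(** * Sets with at most one element *)

Section ToOmega.
Variable R : realType.
Implicit Types (x y : R) (f g : nat -> nat) (S Z X : set R).

Definition single f : nat -> nat := fun n => if n is m.+1 then f m else 1%N.
Definition singlec (r : realc) : realc := fun u => ifc u (r (predc u)) (cst 1).

Lemma Ev1_single r phi f : Ev1 r phi f -> Ev1 (singlec r) phi (single f).
Proof.
move=> hr psi u [|n] hu; apply: (Ev_if hu) => // _; first exact: Ev_cst.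
by apply: (Ev1_app (f := f)); [exact: Ev1W|exact: (Ev_pred hu)].
Qed.

Lemma entry_single f : entry (single f) 0 = f.
Proof. by apply/funext => n; rewrite /entry /= muln1 addn0. Qed.

Lemma fin_includes_single f y X : names f y -> (forall x, X x -> x = y) ->
  fin_includes (single f) X.
Proof.
move=> hf Xy; split=> [i|x /Xy->]; last by exists 0%N => //; rewrite entry_single.
by rewrite /= ltnS leqn0 => /eqP->; exists y; rewrite entry_single.
Qed.

Lemma card1P X : X #= `I_1 -> exists x, X = [set x].
Proof.
move=> /eq_cardSP[x Xx]; rewrite II0 card_eq0 => /eqP h; exists x.
apply/seteqP; split=> [y Xy|y ->] //; apply: contrapT => yx.
by have : (X `\ x) y by []; rewrite h.
Qed.

Lemma card_le1P X : X #<= `I_1 -> X = set0 \/ exists x, X = [set x].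
Proof.
move=> X1; have /finite_setP[n Xn] : finite_set X by apply/finite_set_leP; exists 1%N.
move: X1; rewrite (card_le_eql Xn) card_le_II; case: n Xn => [|[|n]] // Xn _.
  by left; apply/eqP; rewrite -(@card_eq0 _ nat) -II0.
by right; apply: card1P.
Qed.

Definition copy x i : R := (1 + x) / 2 ^+ i.+1.

Lemma copyK x i : 2 ^+ i.+1 * copy x i - 1 = x.
Proof. by rewrite /copy mulrCA mulfV ?gt_eqF ?exprn_gt0 // mulr1 [1 + x]addrC addrK. Qed.
End ToOmega.

(** * Reductions of $\Omega$ and $\Omega_1$ to the other functionals *)

Section Sufficient.
Variable R : realType.
Implicit Types (x y : R) (f g : nat -> nat) (S Z X : set R).

Lemma carrier_I01 F : carrier R F `<=` @I01 R.
Proof. by move=> x []. Qed.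

(** As the names are interleaved, reading one entry further means adding the length [g 0] to the
    position. *)
Definition unscale g : nat -> nat :=
  fun n => if n is 0%N then g 0%N else unq 0 (g (n + g 0)%N).
Definition unscalec (g : realc) : realc :=
  fun u => ifc u (unqc (cst 0) (g (addc u (g (cst 0))))) (g (cst 0)).

Lemma Ev1_unscale (r : realc) phi g : hasE2 phi -> Ev1 r phi g ->
  Ev1 (unscalec r) phi (unscale g).
Proof.
move=> h2 hr psi u [|n] hu; apply: (Ev_if hu) => // _; rewrite /=; ev.
Qed.

Lemma entry_unscale g i : entry (unscale g) i = unqf 0 (entry g i).
Proof.
by apply/funext => m; rewrite /entry /unqf /=; congr (unq 0 (g _)); lia.
Qed.

Lemma copies_set1 k x : copies k [set x] = [set copy x i | i in [set i | k i]].
Proof.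
apply/seteqP; split=> y /=; last first.
  by move=> [i ki <-]; exists i; split=> //=; apply: copyK.
move=> [i [ki /= yx]]; exists i => //; rewrite /copy -yx.
by rewrite addrC subrK mulrC mulKf // gt_eqF // exprn_gt0.
Qed.

Lemma copy_inj x i j : I01 x -> copy x i = copy x j -> i = j.
Proof.
move=> /andP[x0 _]; wlog lt : i j / (i < j)%N.
  move=> h e; case: (ltngtP i j) => // l; first exact: h l e.
  by apply/esym/(h _ _ l).
rewrite /copy => /(mulfI _) e; exfalso.
have : 2 ^+ i.+1 < 2 ^+ j.+1 :> R by rewrite ltr_eXn2l ?ltr1n.
by rewrite -[ltLHS]invrK (e _) ?invrK ?ltxx // gt_eqF //; lra.
Qed.

Lemma copies0 k : copies k set0 = set0 :> set R.
Proof. by apply/seteqP; split=> // y [i []]. Qed.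

Lemma fin_includes_unscale g (k : nat -> bool) X : k 0%N ->
  fin_includes g (copies k X) -> fin_includes (unscale g) X.
Proof.
move=> k0 [h1 h2]; split=> [i /h1[y hy]|x Xx].
  by exists (2 ^+ 1 * y - 1); rewrite entry_unscale; apply: names_unqf.
have [|i lti hi] := h2 (copy x 0).
  by exists 0%N; rewrite k0 copyK.
exists i => //; rewrite entry_unscale -[x](copyK x 0).
exact: names_unqf.
Qed.

Definition yields_omega (D0 : set R -> Prop) u (F : pfun u) :=
  exists c, forall a, set_input D0 a ->
    exists2 g : value tN1, fin_includes g (carrier R a.1) &
      forall b, Ev c (ctx (acat a b) F) (@app [:: tN] g b).

(** The context consists of the set, the number argument, [F] and [E2], at levels 3, 2, 1 and 0. *)
Lemma yields_omegaI D0 u (F : pfun u) (r : realc) :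
  (forall X : value tN2, charfun01 R X -> D0 (carrier R X) ->
     exists2 g, fin_includes g (carrier R X) &
       forall phi, hasE2 phi -> lookup phi 1 = Some (Inp F) ->
         lookup phi 3 = Some (total_input X) -> Ev1 r phi g) ->
  yields_omega D0 F.
Proof.
move=> h; exists (r (var 2)) => -[X []] [/= hX D0X].
have [g hg hr] := h X hX D0X; exists g => // -[n []].
by apply: (Ev1_app (hr _ _ _ _)) => //; apply: Ev_var.
Qed.

Lemma yields_omega_fin D0 D F : (forall X, D0 X -> D X) -> Omega_on D F ->
  yields_omega D0 F.
Proof.
move=> D0D hF; apply: (@yields_omegaI _ _ _ (omc (fun l => memc 3 (app1 l)))).
move=> X hX D0X; have [g hg vg] := omega_value hF (@carrier_I01 X) (D0D _ D0X).
exists g => // phi h2 h1 h3; apply: Ev1_omc h1 _ vg.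
exact/EvS_lam/EvS_mem.
Qed.

Lemma card_copies n x : I01 x -> copies (fun i => i < n)%N [set x] #= `I_n.
Proof.
move=> x01; rewrite copies_set1.
by apply: inj_card_eq => i j _ _; apply: copy_inj.
Qed.

Lemma yields_omega1 n F : (0 < n)%N -> Omega_eq R n F ->
  yields_omega (fun X => X #= `I_1) F.
Proof.
move=> n0 hF.
pose B r := copiesc (fun i => ltc i (cst n)) (memc 3) r.
apply: (@yields_omegaI _ _ _ (unscalec (omc (fun l => B (app1 l))))).
move=> X hX X1; have [x Xx] := card1P X1.
have x01 : I01 x by apply: (@carrier_I01 X); rewrite Xx.
have [|g hg vg] := omega_value hF (@copies_I01 _ (fun i => i < n)%N _ (@carrier_I01 X)).
  by rewrite Xx; apply: card_copies.
exists (unscale g); first exact: fin_includes_unscale hg.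
move=> phi h2 h1 h3; apply: Ev1_unscale => //; apply: Ev1_omc h1 _ vg.
apply/EvS_lam/EvS_copies => //; last exact: EvS_mem.
by ev; apply: Ev_lt; ev.
Qed.

Lemma described_value s t (P : args s -> Prop) Q (F : pfun (s ++ t)) a :
  described P Q F -> P a ->
  exists2 v : value (Fn t), Q a v & forall b, F (acat a b) = Some (app v b).
Proof. by move=> /(_ a)[h _] /h. Qed.

Lemma fun01_cst n : fun01 R (fun=> n).
Proof. by []. Qed.

Lemma inj_input0 X : X `<=` @I01 R -> X #<= `I_1 ->
  inj_input R (chi X, ((fun=> 0%N) : value tN2, tt)).
Proof.
move=> X01 X1; split=> /=; [exact: charfun_chi|exact: fun01_cst|].
rewrite carrier_chi // => x y f g; case: (card_le1P X1) => [->|[z ->]] //.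
by move=> -> ->.
Qed.

(** A constant Y is injective on a set with at most one element, so term 0 of the enumeration is its
    element if there is one. *)
Lemma yields_enumeration F : enumeration R F ->
  yields_omega (fun X => X #<= `I_1) F.
Proof.
move=> hF; pose r : realc := fun u =>
  oracle 1 [:: lam2 (fun l => memc 3 (app1 l)); lam2 (fun=> cst 0); cst 0; u].
apply: (@yields_omegaI _ _ _ (singlec r)) => X hX X1.
have X01 := @carrier_I01 X; have hin := inj_input0 X01 X1.
have [v vX hv] := described_value hF hin; rewrite /= carrier_chi // in vX.
exists (single (v 0%N)).
  case: vX => [[-> v0]|[_ [h _]]].
    apply: (@fin_includes_single _ _ 0) => //.
    rewrite (_ : v 0%N = fun=> 0%N); last exact/funext/v0.
    by rewrite -val_code0; apply: names_cst.
  have [y Xy hy] := h 0%N; apply: fin_includes_single hy _ => x Xx.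
  case: (card_le1P X1) Xx Xy => [->|[z ->]] //.
  by move=> -> ->.
move=> phi h2 h1 h3; apply: Ev1_single => psi u n hu.
apply: (@Ev_oracle 1 _ _ [:: tN2; tN2; tN; tN] F
  (chi (carrier R X), ((fun=> 0%N) : value tN2, (0%N, (n, tt))))).
- exact: lookup_cat.
- apply: EvArgs_lam2; first by apply/EvLamW/EvS_lam/EvS_mem.
  apply: EvArgs_lam2; first by move=> psi' h; apply: Ev_cst.
  by apply: EvArgs_num; [exact: Ev_cst|exact: EvArgs_num].
- exact: (hv (0%N, (n, tt))).
Qed.

Lemma yields_BW F : Omega_BW R F -> yields_omega (fun X => X #<= `I_1) F.
Proof.
move=> hF; pose r : realc := fun u =>
  oracle 1 [:: lam2 (fun l => memc 3 (app1 l)); lam2 (fun=> cst 0); u].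
apply: (@yields_omegaI _ _ _ (singlec r)) => X hX X1.
have X01 := @carrier_I01 X; have hin := inj_input0 X01 X1.
have [v vX hv] := described_value hF hin; rewrite /= carrier_chi // in vX.
exists (single v).
  apply: fin_includes_single vX _ => x.
  by case: (card_le1P X1) => [->|[z ->]] // ->; rewrite sup1.
move=> phi h2 h1 h3; apply: Ev1_single => psi u n hu.
apply: (@Ev_oracle 1 _ _ [:: tN2; tN2; tN] F
  (chi (carrier R X), ((fun=> 0%N) : value tN2, (n, tt)))).
- exact: lookup_cat.
- apply: EvArgs_lam2; first by apply/EvLamW/EvS_lam/EvS_mem.
  apply: EvArgs_lam2; first by move=> psi' h; apply: Ev_cst.
  exact: EvArgs_num.
- exact: (hv (n, tt)).
Qed.

Definition all_copies S : set R := copies (fun=> true) S.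

(** This is the Y that sends [copy x i] to [i]. Off the copies it is 0 outright, as a search for an
    index need not end there. *)
Definition copy_index S : value tN2 := fun f =>
  if `[< exists2 x, all_copies S x & names f x >]
  then least (fun i => `[< exists2 x, S x & names (unqf i f) x >]) else 0%N.

Definition all_copiesc (l : nat) (r : realc) := copiesc (fun=> cst 1) (memc l) r.
Definition copy_indexc (l : nat) (r : realc) :=
  ifc (all_copiesc l r) (mu (fun i => memc l (unqr i r))) (cst 0).

Lemma EvS_all_copies l phi (X : value tN2) : hasE2 phi -> lookup phi l = Some (total_input X) ->
  charfun01 R X -> EvS (all_copiesc l) phi (all_copies (carrier R X)).
Proof.
by move=> h2 hl hX; apply: EvS_copies; [|move=> *; apply: Ev_cst|exact: EvS_mem].
Qed.

Lemma Ev_copy_index l phi (X : value tN2) r f : hasE2 phi -> lookup phi l = Some (total_input X) ->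
  charfun01 R X -> Ev1 r phi f ->
  Ev (copy_indexc l r) phi (copy_index (carrier R X) f).
Proof.
move=> h2 hl hX hr; rewrite /copy_index.
have hA := EvS_app (EvS_all_copies h2 hl hX) hr.
move: hA; rewrite /chi.
case: asboolP => [[y [i [_ Xi]] hy]|_] hA; apply: (Ev_if hA) => // _.
  have [|h3 h4] := @leastP (fun i => `[< exists2 x, carrier R X x & names (unqf i f) x >]).
    by exists i; apply/asboolP; exists (2 ^+ i.+1 * y - 1) => //; apply: names_unqf.
  apply: Ev_mu h3 h4 => psi u n hu.
  have hm : EvS (memc l) (psi ++ phi) (carrier R X) by apply/EvSW/EvS_mem.
  by apply: (EvS_app hm); apply: Ev1_unqr => //; ev.
exact: Ev_cst.
Qed.

Lemma copy_index_copy x i f : I01 x -> names f (copy x i) ->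
  copy_index [set x] f = i.
Proof.
move=> x01 hf; rewrite /copy_index; case: asboolP => [_|[]]; last first.
  by exists (copy x i) => //; exists i; split=> //; apply: copyK.
have hi j : names (unqf j f) x -> j = i.
  move=> /(names_unique (names_unqf j hf)) h; apply: (copy_inj x01).
  have e : 1 + x = 2 ^+ j.+1 * copy x i by apply/eqP; rewrite eq_sym addrC -subr_eq h.
  by rewrite [in LHS]/copy e mulrC mulKf // gt_eqF ?exprn_gt0.
have [|/asboolP[y -> /hi] //] := @leastP (fun i => `[< exists2 y, [set x] y & names (unqf i f) y >]).
exists i; apply/asboolP; exists x => //.
by have := names_unqf i hf; rewrite copyK.
Qed.

Lemma bij_input_copies x : I01 x ->
  bij_input R (chi (all_copies [set x]), (copy_index [set x], tt)).
Proof.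
move=> x01; have A01 : all_copies [set x] `<=` @I01 R.
  by apply: copies_I01 => y ->.
have Ax y : all_copies [set x] y -> exists i, y = copy x i.
  by rewrite /all_copies copies_set1 => -[i _ <-]; exists i.
split=> /=; rewrite ?carrier_chi //.
  split=> /=; first exact: charfun_chi.
    move=> y f g _ hf hg; have [/Ax[i yi]|nA] := pselect (all_copies [set x] y).
      by rewrite yi in hf hg; rewrite !(copy_index_copy x01 hf, copy_index_copy x01 hg).
    have nA' h : names h y -> copy_index [set x] h = 0%N.
      move=> hh; rewrite /copy_index; case: asboolP => // -[z Az hz].
      by case: nA; rewrite (names_unique hh hz).
    by rewrite !nA'.
  rewrite carrier_chi // => y z f g /Ax[i ->] /Ax[j ->] hf hg.
  by rewrite (copy_index_copy x01 hf) (copy_index_copy x01 hg) => ->.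
move=> n; exists (copy x n), (name_of (copy x n)); split.
- by exists n; split=> //; apply: copyK.
- exact: names_name_of.
- exact/(copy_index_copy x01)/names_name_of.
Qed.

(** Term 0 of the enumeration is a copy of x with unknown index; Y computes the index, and [unqr]
    undoes the copy. *)
Lemma yields_weak_enumeration F : weak_enumeration R F ->
  yields_omega (fun X => X #= `I_1) F.
Proof.
move=> hF; pose r : realc := fun u => oracle 1
  [:: lam2 (fun l => all_copiesc 3 (app1 l)); lam2 (fun l => copy_indexc 3 (app1 l));
      cst 0; u].
apply: (@yields_omegaI _ _ _ (singlec (unqr (copy_indexc 3 r) r))) => X hX X1.
have X01 := @carrier_I01 X; have [x Xx] := card1P X1.
have x01 : I01 x by apply: X01; rewrite Xx.
have A01 : all_copies [set x] `<=` @I01 R by apply: copies_I01 => y ->.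
have [v vX hv] := described_value hF (bij_input_copies x01).
rewrite /= carrier_chi // in vX.
have {vX}[i hi] : exists i, names (v 0%N) (copy x i).
  case: vX => [[A0 _]|[_ [/(_ 0%N)[y Ay hy] _]]].
    suff : all_copies [set x] (copy x 0) by rewrite A0.
    by exists 0%N; split=> //; apply: copyK.
  by move: Ay hy; rewrite /all_copies copies_set1 => -[i _ <-]; exists i.
exists (single (unqf i (v 0%N))).
  apply: (@fin_includes_single _ _ x) => [|y]; last by rewrite Xx.
  by have := names_unqf i hi; rewrite copyK.
move=> phi h2 h1 h3; apply: Ev1_single.
have hr : Ev1 r phi (v 0%N).
  move=> psi u n hu.
  apply: (@Ev_oracle 1 _ _ [:: tN2; tN2; tN; tN] F
    (chi (all_copies [set x]), (copy_index [set x], (0%N, (n, tt))))).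
  - exact: lookup_cat.
  - rewrite -Xx; apply: EvArgs_lam2; first by apply/EvLamW/EvS_lam/EvS_all_copies.
    apply: EvArgs_lam2.
      move=> psi' h; apply: Ev_copy_index => //; try by ev.
      exact/Ev1_app1/lookup_size.
    by apply: EvArgs_num; [exact: Ev_cst|exact: EvArgs_num].
  - exact: (hv (0%N, (n, tt))).
apply: Ev1_unqr => //; rewrite -(copy_index_copy x01 hi) -Xx.
exact: Ev_copy_index.
Qed.

Lemma sup_max S x : S x -> (forall y, S y -> y <= x) -> sup S = x.
Proof.
move=> Sx h; apply/le_anti/andP; split; first by apply: ge_sup => //; exists x.
by apply: ub_le_sup => //; exists x.
Qed.

(** The copies of x decrease with their index, so their supremum is copy 0. *)
Lemma yields_weak_BW F : weak_Omega_BW R F ->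
  yields_omega (fun X => X #= `I_1) F.
Proof.
move=> hF; pose r : realc := fun u => oracle 1
  [:: lam2 (fun l => all_copiesc 3 (app1 l)); lam2 (fun l => copy_indexc 3 (app1 l)); u].
apply: (@yields_omegaI _ _ _ (singlec (unqr (cst 0) r))) => X hX X1.
have X01 := @carrier_I01 X; have [x Xx] := card1P X1.
have x01 : I01 x by apply: X01; rewrite Xx.
have A01 : all_copies [set x] `<=` @I01 R by apply: copies_I01 => y ->.
have [v vX hv] := described_value hF (bij_input_copies x01).
have sE : sup (all_copies [set x]) = copy x 0.
  apply: sup_max => [|y]; first by exists 0%N; split=> //; apply: copyK.
  rewrite /all_copies copies_set1 => -[i _ <-].
  case/andP: x01 => x0 _; rewrite /copy ler_pM2l; last by lra.
  by rewrite lef_pV2 ?posrE ?exprn_gt0 // ler_eXn2l ?ltr1n.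
rewrite /= carrier_chi // sE in vX.
exists (single (unqf 0 v)).
  apply: (@fin_includes_single _ _ x) => [|y]; last by rewrite Xx.
  by have := names_unqf 0 vX; rewrite copyK.
move=> phi h2 h1 h3; apply: Ev1_single.
have hr : Ev1 r phi v.
  move=> psi u n hu.
  apply: (@Ev_oracle 1 _ _ [:: tN2; tN2; tN] F
    (chi (all_copies [set x]), (copy_index [set x], (n, tt)))).
  - exact: lookup_cat.
  - rewrite -Xx; apply: EvArgs_lam2; first by apply/EvLamW/EvS_lam/EvS_all_copies.
    apply: EvArgs_lam2; last exact: EvArgs_num.
    move=> psi' h; apply: Ev_copy_index => //; try by ev.
    exact/Ev1_app1/lookup_size.
  - exact: (hv (n, tt)).
by apply: Ev1_unqr => //; apply: Ev_cst.
Qed.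

(** The rational -1 lies below [0,1]: asking for points above it is asking for points at all. *)
Definition code_m1 := CodeSeq.code [:: 0%N; 1%N].

Lemma val_code_m1 : val_code R code_m1 = -1.
Proof. by rewrite /val_code /rat_of_code CodeSeq.codeK /= divr1 sub0r rmorphN rmorph1. Qed.

(** The bound [n0] for the empty set is exceeded by the bound for [n0 + 1]
    copies of a singleton. *)
Lemma yields_ge_card F : Omega_ge_card_fin R F ->
  yields_omega (fun X => X #<= `I_1) F.
Proof.
move=> hF.
pose N0 : code := oracle 1 [:: lam2 (fun=> cst 0)].
(* Cutting X at c before copying turns the emptiness test into the question c < x, from which a name
   of x is computed. *)
pose B c : realc -> code :=
  copiesc (fun i => leqc i N0) (fun r => andc (memc 3 r) (gtc r c)).
pose T (c : code) : code := ltc N0 (oracle 1 [:: lam2 (fun l => B c (app1 l))]).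
pose out : realc := fun u => ifc (T (cst code_m1)) (singlec (name_ofc T) u) (cst 0).
apply: (@yields_omegaI _ _ _ out) => X hX X1.
have X01 := @carrier_I01 X; pose A c := carrier R X `&` [set x | val_code R c < x].
have hval S : S `<=` @I01 R -> finite_set S ->
    exists2 n, S #<= `I_n & F (chi S, tt) = Some n.
  move=> S01 fS; have [|n] := @described_value [:: tN2] [::] _ _ F (chi S, tt) hF.
    by split; [exact: charfun_chi|rewrite carrier_chi].
  by rewrite /= carrier_chi // => Sn /(_ tt); exists n.
have [||n0 _ hn0] := hval set0 => //.
have hT phi : hasE2 phi -> lookup phi 1 = Some (Inp F) ->
    lookup phi 3 = Some (total_input X) -> Ev1 T phi (fun c => `[< A c !=set0 >]).
  move=> h2 h1 h3 psi u c hu.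
  pose k i := (i < n0.+1)%N.
  have hN0 psi' : Ev N0 (psi' ++ psi ++ phi) n0.
    apply: (@Ev_oracle 1 _ _ [:: tN2] F (@chi R set0, tt)) => //.
      by do 2 apply: lookup_cat.
    apply: EvArgs_lam2 => // psi2 h.
    rewrite (_ : @chi R set0 h = 0%N); first exact: Ev_cst.
    by rewrite /chi; case: asboolP => // -[].
  have A01 : A c `<=` @I01 R by move=> y [/X01].
  have C01 := @copies_I01 _ k _ A01.
  have hB : EvS (B u) (psi ++ phi) (copies k (A c)).
    apply: EvS_copies; [by ev|by move=> psi3 v m hv; rewrite /k ltnS; apply: Ev_leq; [exact: hv|exact: (hN0 psi3)]|].
    apply: EvS_and; last by apply: EvP_gt => //; ev.
    by apply: EvS_mem => //; ev.
  have Ac : A c = set0 \/ exists2 x, I01 x & A c = [set x].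
    have [Xc|[x Xc]] := card_le1P X1; first by left; rewrite /A Xc set0I.
    have x01 : I01 x by apply: X01; rewrite Xc.
    have [cx|cx] := boolP (val_code R c < x); [right; exists x => //|left];
      rewrite /A Xc; apply/seteqP; split=> // y [].
      by move=> ->.
    by move=> -> /=; rewrite (negPf cx).
  have fC : finite_set (copies k (A c)).
    case: Ac => [->|[x x01 ->]]; first by rewrite copies0.
    by apply/finite_setP; exists n0.+1; apply: card_copies.
  have [n nC hn] := hval _ C01 fC.
  have -> : `[< A c !=set0 >] = (n0 < n)%N.
    case: Ac nC hn => [->|[x x01 ->]].
      rewrite copies0 hn0 => _ [<-]; rewrite ltnn.
      by apply/asboolP => -[].
    rewrite (card_le_eql (card_copies n0.+1 x01)) card_le_II => -> _.
    by apply/asboolP; exists x.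
  apply: Ev_lt; first exact: (hN0 [::]).
  apply: (@Ev_oracle 1 _ _ [:: tN2] F (chi (copies k (A c)), tt)) => //.
    exact: lookup_cat.
  by apply: EvArgs_lam2 => //; apply: EvS_lam.
have [X0|[x Xx]] := card_le1P X1.
  exists (fun=> 0%N); first by rewrite X0; split.
  move=> phi h2 h1 h3 psi u n hu.
  have := Ev1_app (hT _ h2 h1 h3) (Ev_cst code_m1 phi).
  rewrite /A X0 set0I asboolF => [h|[]//].
  by apply: (Ev_if (EvW psi h)) => // _; apply: Ev_cst.
have x01 : I01 x by apply: X01; rewrite Xx.
exists (single (name_of x)).
  by apply: fin_includes_single (names_name_of x) _; rewrite Xx.
move=> phi h2 h1 h3 psi u n hu.
have := Ev1_app (hT _ h2 h1 h3) (Ev_cst code_m1 phi).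
rewrite asboolT => [h|]; last first.
  exists x; split; rewrite ?Xx //= val_code_m1; case/andP: x01; lra.
apply: (Ev_if (EvW psi h)) => // _.
have {}h2 : hasE2 (psi ++ phi) by ev.
apply: (Ev1_app (f := single (name_of x))) => //; apply/Ev1_single/Ev_name_of => //.
have {}hT : Ev1 T (psi ++ phi) (fun c => `[< A c !=set0 >]).
  by apply: hT => //; apply: lookup_cat.
move=> psi' v c hv; have := hT psi' v c hv.
suff -> : `[< A c !=set0 >] = (val_code R c < x) by [].
apply/asboolP/idP => [[y []]|cx]; first by rewrite Xx => ->.
by exists x; rewrite /A Xx.
Qed.
End Sufficient.

(** * Computing the other functionals from Omega or Omega_1 *)

Section Fibers.
Variable R : realType.
Implicit Types (x y : R) (f g : nat -> nat) (S Z X : set R).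

Definition above (c : nat) : set R := [set x | val_code R c < x].

(** Questions about points of [S] above c determine the rational cut of [sup S], which is what
    [Ev_name_of] needs. *)
Lemma above_sup S c : S `<=` @I01 R -> S !=set0 ->
  `[< S `&` above c !=set0 >] = (val_code R c < sup S).
Proof.
move=> S01 S0; apply/asboolP/idP => [[x [Sx cx]]|/(sup_gt S0)[x Sx cx]]; last by exists x.
apply: lt_le_trans cx _; apply: ub_le_sup => //.
by exists 1 => y /S01 /andP[].
Qed.

Lemma above_m1 S : S `<=` @I01 R -> S `&` above code_m1 = S.
Proof.
move=> S01; apply/setIidl => x /S01 /andP[x0 _].
by rewrite /above /= val_code_m1; lra.
Qed.

Definition fiber (A Y : value tN2) (n : nat) : set R :=
  [set x | carrier R A x /\ exists2 f, names f x & Y f = n].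

Definition fiberc (lA lY : nat) (n : code) (r : realc) : code :=
  andc (memc lA r) (eqc (app2 lY r) n).

Lemma fiber_I01 A Y n : fiber A Y n `<=` @I01 R.
Proof. by move=> x [[]]. Qed.

Lemma EvS_fiber lA lY phi A Y t n : hasE2 phi ->
  lookup phi lA = Some (total_input A) -> lookup phi lY = Some (total_input Y) ->
  charfun01 R A -> fun01 R Y -> Ev t phi n ->
  EvS (fiberc lA lY t) phi (fiber A Y n).
Proof.
move=> h2 hA hY cA fY ht psi r f hr; rewrite /chi.
have -> : `[< exists2 x, fiber A Y n x & names f x >] =
    `[< exists2 x, carrier R A x & names f x >] && (Y f == n).
  apply/asboolP/andP => [[x [Ax [g hg <-]] hf]|[/asboolP[x Ax hf] /eqP Yf]].
    split; first by apply/asboolP; exists x.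
    by apply/eqP; apply: (fY x) => //; case: Ax.
  by exists x => //; split=> //; exists f.
apply: Ev_and => [|_]; first exact: (EvS_mem h2 hA cA).
by apply: Ev_eq; ev.
Qed.

Definition fiber_abovec (lA lY : nat) (n c : code) : code :=
  foundc (omc (fun l => fiberc lA lY n (app1 l)))
    (fun r => andc (fiberc lA lY n r) (gtc r c)).

(** Empty fibers leave gaps in the enumeration; they are filled with the point of the first nonempty
    fiber. *)
Definition enumc (lA lY : nat) (n m : code) : code :=
  let ne k := fiber_abovec lA lY k (cst code_m1) in
  let k := ifc (ne n) n (mu ne) in
  ifc (exc ne) (name_ofc (fiber_abovec lA lY k) m) (cst 0).

Definition supc (lA lY : nat) (m : code) : code :=
  let T c := exc (fun n => fiber_abovec lA lY n c) in
  ifc (T (cst code_m1)) (name_ofc T m) (cst 0).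

Definition enum_of (A Y : value tN2) : nat -> nat -> nat := fun n m =>
  if pselect (exists k, `[< fiber A Y k !=set0 >])
  then name_of (sup (fiber A Y
    (if `[< fiber A Y n !=set0 >] then n
     else least (fun k => `[< fiber A Y k !=set0 >])))) m
  else 0%N.

Definition sup_of (A : value tN2) : nat -> nat := fun m =>
  if pselect (carrier R A !=set0) then name_of (sup (carrier R A)) m else 0%N.

Lemma Ev_ifP t u v phi (P : Prop) a b : Ev t phi `[< P >] ->
  (P -> Ev u phi a) -> (~ P -> Ev v phi b) ->
  Ev (ifc t u v) phi (if pselect P then a else b).
Proof.
move=> ht hu hv; apply: (Ev_if ht).
  by case: asboolP => // p _; case: pselect => // _; apply: hu.
by case: asboolP => // np _; case: pselect => // _; apply: hv.
Qed.

Section Programs.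
Variables (D : set R -> Prop) (w : pfun [:: tN2; tN]) (lA lY : nat).
Variables (A Y : value tN2) (phi : seq input).
Hypotheses (hw : Omega_on D w) (h2 : hasE2 phi) (h1 : lookup phi 1 = Some (Inp w)).
Hypotheses (hA : lookup phi lA = Some (total_input A)).
Hypotheses (hY : lookup phi lY = Some (total_input Y)).
Hypotheses (cA : charfun01 R A) (fY : fun01 R Y) (hD : forall n, D (fiber A Y n)).

Lemma Ev_fiber_above psi t u n c : Ev t (psi ++ phi) n -> Ev u (psi ++ phi) c ->
  Ev (fiber_abovec lA lY t u) (psi ++ phi) `[< fiber A Y n `&` above c !=set0 >].
Proof.
move=> ht hu.
have hF : EvS (fiberc lA lY t) (psi ++ phi) (fiber A Y n).
  by apply: EvS_fiber => //; try exact: lookup_cat.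
apply: (Ev_omega hw (Z := fiber A Y n)) => //; try exact: lookup_cat.
- exact: EvS_lam.
- exact: fiber_I01.
- by apply: EvS_and => //; apply: EvP_gt => //; exact: lookup_cat.
- by move=> [x [Fx cx]]; exists x.
Qed.

Lemma Ev_fiber psi t n : Ev t (psi ++ phi) n ->
  Ev (fiber_abovec lA lY t (cst code_m1)) (psi ++ phi) `[< fiber A Y n !=set0 >].
Proof.
move=> ht; have := Ev_fiber_above ht (Ev_cst code_m1 _).
by rewrite above_m1 //; exact: fiber_I01.
Qed.

Lemma Ev_enum t u n m : Ev t phi n -> Ev u phi m ->
  Ev (enumc lA lY t u) phi (enum_of A Y n m).
Proof.
move=> ht hu; have hne : Ev1 (fun k => fiber_abovec lA lY k (cst code_m1)) phi
    (fun k => `[< fiber A Y k !=set0 >]) by move=> psi v k; exact: Ev_fiber.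
apply: Ev_ifP => [|ex|_]; [exact: Ev_ex| |exact: Ev_cst].
set k := (k in fiber_abovec _ _ k); set i := (i in fiber _ _ i).
have hl := leastP ex.
have hk : Ev k phi i.
  rewrite /k /i; apply: (Ev_if (@Ev_fiber [::] _ _ ht)); case: asboolP => // _ _.
  exact: Ev_mu hne hl.1 hl.2.
have Fi : fiber A Y i !=set0.
  by rewrite /i; case: asboolP => // _; apply/asboolP; exact: hl.1.
apply: (Ev1_app _ hu); apply: Ev_name_of => // psi v c hv.
rewrite -above_sup //; last exact: fiber_I01.
by apply: Ev_fiber_above => //; apply: EvW.
Qed.

(** The fibers exhaust A, so the cut of its supremum is a number quantifier, answered by [E2], over
    questions about single fibers. *)
Lemma fibersE S : (exists n, fiber A Y n `&` S !=set0) <-> carrier R A `&` S !=set0.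
Proof.
split=> [[n [x [[Ax _] Sx]]]|[x [Ax Sx]]]; first by exists x.
exists (Y (name_of x)), x; split=> //; split=> //.
by exists (name_of x) => //; apply: names_name_of.
Qed.

Lemma Ev_sup t m : Ev t phi m -> Ev (supc lA lY t) phi (sup_of A m).
Proof.
move=> ht; have hT : Ev1 (fun c => exc (fun n => fiber_abovec lA lY n c)) phi
    (fun c => `[< carrier R A `&` above c !=set0 >]).
  move=> psi u c hu; rewrite -(asbool_equiv_eq (fibersE _)).
  rewrite (_ : (exists n, _) = exists n, `[< fiber A Y n `&` above c !=set0 >]).
    apply: Ev_ex => [|psi' v n hv]; first exact: lookup_cat.
    by rewrite catA; apply: Ev_fiber_above; rewrite -catA //; apply: EvW.
  by rewrite propeqE; split=> -[n] /asboolP; exists n.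
have A01 := @carrier_I01 R A.
apply: Ev_ifP => [|A0|_]; [|apply: (Ev1_app _ ht)|exact: Ev_cst].
  by have := Ev1_app hT (Ev_cst code_m1 _); rewrite above_m1.
apply: Ev_name_of => // psi u c hu; rewrite -above_sup //; exact: hT.
Qed.
End Programs.

(** For an empty carrier the constant 0 serves: it names 0, the value of [sup] there. *)
Lemma names_sup_of A : names (sup_of A) (sup (carrier R A)).
Proof.
rewrite /sup_of; case: pselect => [A0|nA0] /=; first exact: names_name_of.
by rewrite ((nonemptyPn _).1 nA0) sup0 -(val_code0 R); apply: names_cst.
Qed.

Lemma inj_fiber1 A Y x n : inj_on (carrier R A) Y -> fiber A Y n x ->
  fiber A Y n = [set x].
Proof.
move=> inj [Ax [f hf Yf]]; apply/seteqP; split=> [y [Ay [g hg Yg]]|y ->].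
  by apply: (inj y x g f) => //; rewrite Yf Yg.
by split=> //; exists f.
Qed.

Lemma enum_of_enumerates A Y : fun01 R Y -> inj_on (carrier R A) Y ->
  enumerates (enum_of A Y) (carrier R A).
Proof.
move=> fY inj; have := @fibersE A Y setT; rewrite setIT => hf.
have nameE n x : fiber A Y n x -> enum_of A Y n = name_of x.
  move=> Fx; apply/funext => m; rewrite /enum_of; case: pselect => /= [_|nex]; last first.
    by exfalso; apply: nex; exists n; apply/asboolP; exists x.
  by rewrite asboolT ?(inj_fiber1 inj Fx) ?sup1 //; exists x.
have [A0|/nonemptyPn A0] := pselect (carrier R A !=set0); [right|left]; last first.
  split=> // n m; rewrite /enum_of; case: pselect => // ex; exfalso.
  by case: ex => k /asboolP[x [Ax _]]; rewrite A0 in Ax.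
split=> //; split=> [n|x Ax].
  have /hf[k0 [x0 [F0 _]]] := A0.
  have [|hl _] := @leastP (fun k => `[< fiber A Y k !=set0 >]).
    by exists k0; apply/asboolP; exists x0.
  rewrite /enum_of; set k := (k in fiber A Y k).
  have [x Fx] : fiber A Y k !=set0.
    by rewrite /k; case: asboolP => // _; apply/asboolP.
  exists x; first by case: Fx.
  case: pselect => /= [_|nex]; last first.
    by exfalso; apply: nex; exists k0; apply/asboolP; exists x0.
  by rewrite (inj_fiber1 inj Fx) sup1; exact: names_name_of.
(* A point is listed at the index that Y gives to it. *)
exists (Y (name_of x)); rewrite (@nameE _ x); first exact: names_name_of.
by split=> //; exists (name_of x) => //; exact: names_name_of.
Qed.

Lemma fiber_le1 A Y n : inj_on (carrier R A) Y -> fiber A Y n #<= `I_1.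
Proof.
move=> inj; have [[x Fx]|/nonemptyPn ->] := pselect (fiber A Y n !=set0).
  by rewrite (inj_fiber1 inj Fx) (card_le_eql card_set1) card_lexx.
exact: card_ge0.
Qed.

Lemma fiber_eq1 A Y n : inj_on (carrier R A) Y -> surj_on (carrier R A) Y ->
  fiber A Y n #= `I_1.
Proof.
move=> inj /(_ n)[x [f [Ax hf Yf]]].
have Fx : fiber A Y n x by split=> //; exists f.
by rewrite (inj_fiber1 inj Fx) card_set1.
Qed.
End Fibers.

(** * Listing and counting a finite set from its rational cuts *)

Section Listing.
Variable R : realType.
Implicit Types (x y : R) (f g : nat -> nat) (S Z X : set R).

Lemma finite_max S : finite_set S -> S !=set0 ->
  exists2 x, S x & forall y, S y -> y <= x.
Proof.
move=> /finite_seqP[s ->]; elim: s => [[x //]|a s IHs _].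
have [[x xs]|s0] := pselect ([set` s] !=set0).
  have [|m ms mP] := IHs; first by exists x.
  exists (Num.max a m).
    by rewrite /= inE; case: leP; rewrite ?ms ?orbT ?eqxx.
  by move=> y; rewrite /= inE le_max => /orP[/eqP->|/mP->]; rewrite ?lexx ?orbT.
exists a; first by rewrite /= inE eqxx.
move=> y; rewrite /= inE => /orP[/eqP->//|ys].
by case: s0; exists y.
Qed.

Lemma finite_sup S : finite_set S -> S !=set0 ->
  S (sup S) /\ forall y, S y -> y <= sup S.
Proof. by move=> fS S0; have [x Sx xP] := finite_max fS S0; rewrite (sup_max Sx xP). Qed.

(** With a rational q between x and the next larger element, x is the maximum of the part of [S] up
    to q; so rational bounds reach every element. *)
Lemma gap_above S x : finite_set S ->
  exists2 q, x < val_code R q & forall y, S y -> y <= val_code R q -> y <= x.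
Proof.
move=> /finite_seqP[s ->].
have [e xe eP] : exists2 e, x < e & forall y, y \in s -> x < y -> e <= y.
  elim: s => [|a s [e xe eP]]; first by exists (x + 1) => //; lra.
  have [xa|ax] := ltP x a; [exists (Num.min a e)|exists e] => //.
  - by rewrite lt_min xa.
  - by move=> y; rewrite inE ge_min => /orP[/eqP->|/eP h /h->]; rewrite ?lexx ?orbT.
  - by move=> y; rewrite inE => /orP[/eqP->|/eP //]; rewrite ltNge ax.
have [q xq qe] := val_code_dense xe; exists q => // y ys yq.
by rewrite leNgt; apply/negP => /(eP _ ys); lra.
Qed.

Definition below X (q : nat) : set R := X `&` [set x | x <= val_code R q].

Lemma below_sub X q : below X q `<=` X.
Proof. by move=> x []. Qed.

(** Equality of the maxima of two lower parts, expressed by the computable answers. *)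
Definition same X (i j : nat) : bool := `[< forall c,
  `[< below X i `&` above c !=set0 >] = `[< below X j `&` above c !=set0 >] >].

Definition covers X (L : nat) : bool :=
  `[< forall j, exists2 i, (i < L)%N & same X i j >].

Definition len X := least (covers X).

Definition item X (i m : nat) : nat :=
  if pselect (below X i !=set0) then name_of (sup (below X i)) m else 0%N.

Definition listing X : nat -> nat := fun n =>
  if n is m.+1 then item X (m %% len X) (m %/ len X) else len X.

Definition newb X (i : nat) : bool := `[< below X i !=set0 >] &&
  ~~ `[< exists j, (j < i)%N && same X j i >].

Definition count_list X := iter_nat 0 (fun i n => (n + newb X i)%N) (len X).

Section Finite.
Variables (X : set R) (X01 : X `<=` @I01 R) (finX : finite_set X).

Lemma below01 q : below X q `<=` @I01 R.
Proof. by move=> x /below_sub /X01. Qed.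

Lemma finite_below q : finite_set (below X q).
Proof. exact: (sub_finite_set (@below_sub X q) finX). Qed.

(** The value -1 marks an empty lower part and cannot be a maximum, since X lies in [0,1]. *)
Definition key q : R := if pselect (below X q !=set0) then sup (below X q) else -1.

(** The maximum with -1 matters for an empty lower part, where a rational below -1 would otherwise
    pass. *)
Lemma keyP q c : `[< below X q `&` above c !=set0 >] = (Num.max (val_code R c) (-1) < key q).
Proof.
rewrite /key; case: pselect => [b0|nb0]; last first.
  rewrite gt_max ltxx andbF; apply/asboolP => -[x [bx _]].
  by apply: nb0; exists x.
rewrite above_sup //; last exact: below01.
rewrite gt_max; suff -> : -1 < sup (below X q) by rewrite andbT.
have [/below01/andP[h _] _] := finite_sup (finite_below q) b0; lra.
Qed.

Lemma key_ge q : -1 <= key q.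
Proof.
rewrite /key; case: pselect => //= b0.
have [/below01/andP[h _] _] := finite_sup (finite_below q) b0; lra.
Qed.

Lemma sameP i j : same X i j = (key i == key j).
Proof.
apply/asboolP/eqP => [h|e c]; last by rewrite !keyP e.
apply: contrapT => /eqP.
wlog lt : i j h / key i < key j.
  move=> th; rewrite neq_lt => /orP[lt|lt].
    by apply: (th i j h lt); rewrite lt_eqF.
  by apply: (th j i (fun c => esym (h c)) lt); rewrite lt_eqF.
(* A rational between the keys is at least -1, so it gives different answers for the two lower
   parts. *)
have [c c1 c2] := val_code_dense lt.
have := h c; rewrite !keyP; have := key_ge i.
have -> : Num.max (val_code R c) (-1) = val_code R c.
  by apply/max_idPl; have := key_ge i; lra.
by rewrite c2 => _; rewrite ltNge (ltW c1).
Qed.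

Lemma key_below q : below X q !=set0 -> X (key q).
Proof.
move=> b0; rewrite /key; case: pselect => // b1.
by have [/below_sub] := finite_sup (finite_below q) b0.
Qed.

Lemma key_or q : key q = -1 \/ X (key q).
Proof.
have [b0|b0] := pselect (below X q !=set0); first by right; apply: key_below.
by left; rewrite /key; case: pselect.
Qed.

(** Each key is -1 or one of the finitely many points of X; one index for every attained value
    suffices. *)
Lemma covers_ex : exists L, covers X L.
Proof.
have [s Xs] := (finite_seqP _).1 finX.
have : forall j, key j \in -1 :: s.
  move=> j; rewrite inE; have [->|] := key_or j; first by rewrite eqxx.
  by rewrite Xs /= => ->; rewrite orbT.
suff : forall t : seq R, exists L,
    forall j, key j \in t -> exists2 i, (i < L)%N & key i = key j.
  move=> /(_ (-1 :: s))[L hL] hs; exists L; apply/asboolP => j.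
  by have [i iL e] := hL _ (hs j); exists i => //; rewrite sameP e.
elim=> [|a t [L hL]]; first by exists 0%N.
have [[k ka]|nk] := pselect (exists k, key k = a); last first.
  exists L => j; rewrite inE => /orP[/eqP e|/hL //].
  by case: nk; exists j.
exists (maxn L k.+1) => j; rewrite inE => /orP[/eqP->|/hL[i iL e]].
  by exists k => //; rewrite leq_max ltnSn orbT.
by exists i => //; rewrite leq_max iL.
Qed.

Lemma covers_len : covers X (len X).
Proof. by have [] := leastP covers_ex. Qed.

Lemma key_onto x : X x -> exists2 i, (i < len X)%N & key i = x.
Proof.
move=> Xx; have [q xq qP] := gap_above x finX.
have /asboolP/(_ q)[i iL] := covers_len; rewrite sameP => /eqP e.
exists i => //; rewrite e /key; case: pselect => /= [b0|nb0]; last first.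
  by exfalso; apply: nb0; exists x; split=> //; apply: ltW.
by apply: sup_max => [|y [Xy yq]]; [split=> //; apply: ltW|apply: qP].
Qed.

Lemma len_gt0 : (0 < len X)%N.
Proof.
by have /asboolP/(_ 0%N)[i iL _] := covers_len; apply: leq_trans iL.
Qed.

Lemma entry_listing i : (i < len X)%N -> entry (listing X) i = item X i.
Proof.
move=> iL; apply/funext => m; rewrite /entry /= modnMDl modn_small //.
by rewrite divnMDl ?len_gt0 // divn_small // addn0.
Qed.

Lemma listing_includes : fin_includes (listing X) X.
Proof.
split=> [i iL|x Xx].
  rewrite entry_listing //; rewrite /item; case: pselect => /= _.
    by exists (sup (below X i)); apply: names_name_of.
  by exists (val_code R 0); apply: names_cst.
have [i iL ix] := key_onto Xx; exists i => //; rewrite entry_listing //.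
rewrite -ix /item /key; case: pselect => /= [_|b0]; first exact: names_name_of.
have : X (-1) by move: Xx; rewrite -ix /key; case: pselect.
by move/X01 => /andP[]; lra.
Qed.

Lemma newP i : newb X i <-> X (key i) /\ forall j, (j < i)%N -> key j != key i.
Proof.
rewrite /newb; split=> [/andP[/asboolP b0 /asboolPn h]|[Xi h]].
  split; first exact: key_below.
  by move=> j ji; apply/negP => e; apply: h; exists j; rewrite ji sameP.
apply/andP; split.
  apply/asboolP; apply: contrapT => b0; move: Xi; rewrite /key.
  case: pselect => /= [b1|_]; first by have := b0 b1.
  by move/X01 => /andP[]; lra.
apply/asboolPn => -[j /andP[ji]]; rewrite sameP; exact/negP/h.
Qed.

Lemma card_count (p : nat -> bool) n :
  [set i | (i < n)%N /\ p i] #= `I_(iter_nat 0 (fun i m => (m + p i)%N) n).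
Proof.
elim: n => [|n IHn] /=.
  rewrite (_ : [set i | _] = set0) ?II0 ?card_eqxx //.
  by apply/seteqP; split=> // i [].
have [pn|pn] := boolP (p n); rewrite ?addn1 ?addn0.
  apply/eq_cardSP; exists n; first by split.
  rewrite (_ : _ `\ n = [set i | (i < n)%N /\ p i]) //.
  apply/seteqP; split=> i /=.
    by move=> [[]]; rewrite ltnS leq_eqVlt => /orP[/eqP->|].
  by move=> [lt pi]; split; [split=> //; exact: ltnW|move=> e; rewrite e ltnn in lt].
rewrite (_ : [set i | _] = [set i | (i < n)%N /\ p i]) //.
apply/seteqP; split=> i /= [lt pi]; split=> //; last exact: ltnW.
by move: lt pi pn; rewrite ltnS leq_eqVlt => /orP[/eqP-> ->|].
Qed.

(** [key] maps the indices counted as new bijectively onto X. *)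
Lemma card_count_list : X #= `I_(count_list X).
Proof.
have e := card_count (newb X) (len X); apply: card_eq_trans e.
set N := [set i | _]; have keyN : [set key i | i in N] #= N.
  apply: inj_card_eq => i j /set_mem[_ /newP[_ hi]] /set_mem[_ /newP[_ hj]] eij.
  case: (ltngtP i j) => // lt.
    by have := hj _ lt; rewrite eij eqxx.
  by have := hi _ lt; rewrite eij eqxx.
suff {1}<- : [set key i | i in N] = X by [].
apply/seteqP; split=> [x [i [_ /newP[Xi _]] <-] //|x Xx].
have [k kL kx] := key_onto Xx.
have [|/eqP h1 h2] := @leastP (fun i => key i == x); first by exists k; rewrite kx.
exists (least (fun i => key i == x)) => //; split.
  by apply: leq_ltn_trans (h2 k _) kL; rewrite kx.
apply/newP; rewrite h1; split=> // j ji; apply/negP => /h2.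
by rewrite leqNgt ji.
Qed.
End Finite.

Definition modc t u := mu (fun i => exc (fun m => andc (ltc i u) (eqc t (addc (mulc m u) i)))).
Definition divc t u := mu (fun m => exc (fun i => andc (ltc i u) (eqc t (addc (mulc m u) i)))).

Lemma Ev_mod t u phi n d : hasE2 phi -> (0 < d)%N -> Ev t phi n -> Ev u phi d ->
  Ev (modc t u) phi (n %% d).
Proof.
move=> h2 d0 ht hu.
have hp : Ev1 (fun i => exc (fun m => andc (ltc i u) (eqc t (addc (mulc m u) i)))) phi
    (fun i => `[< exists m, (i < d)%N && (n == m * d + i)%N >]).
  by ev; apply: Ev_lt || apply: Ev_eq; ev; apply: Ev_add; ev; apply: Ev_mul; ev.
apply: (Ev_mu hp).
  by apply/asboolP; exists (n %/ d)%N; rewrite ltn_mod d0 -divn_eq eqxx.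
by move=> i /asboolP[m /andP[id /eqP->]]; rewrite modnMDl modn_small.
Qed.

Lemma Ev_div t u phi n d : hasE2 phi -> (0 < d)%N -> Ev t phi n -> Ev u phi d ->
  Ev (divc t u) phi (n %/ d).
Proof.
move=> h2 d0 ht hu.
have hp : Ev1 (fun m => exc (fun i => andc (ltc i u) (eqc t (addc (mulc m u) i)))) phi
    (fun m => `[< exists i, (i < d)%N && (n == m * d + i)%N >]).
  by ev; apply: Ev_lt || apply: Ev_eq; ev; apply: Ev_add; ev; apply: Ev_mul; ev.
apply: (Ev_mu hp).
  by apply/asboolP; exists (n %% d)%N; rewrite ltn_mod d0 -divn_eq eqxx.
by move=> m /asboolP[i /andP[id /eqP->]]; rewrite divnMDl // divn_small // addn0.
Qed.

Section Programs.
Variables (Rc : code -> code -> code) (X : set R) (phi : seq input).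
Hypotheses (X01 : X `<=` @I01 R) (finX : finite_set X) (h2 : hasE2 phi).
Hypothesis hR : forall psi u v c q, Ev u (psi ++ phi) c -> Ev v (psi ++ phi) q ->
  Ev (Rc u v) (psi ++ phi) `[< below X q `&` above c !=set0 >].

Definition samec i j := notc (exc (fun c => notc (eqc (Rc c i) (Rc c j)))).
Definition coversc L := notc (exc (fun j => notc (exc (fun i =>
  andc (ltc i L) (samec i j))))).
Definition lenc := mu coversc.
Definition itemc i m :=
  ifc (Rc (cst code_m1) i) (name_ofc (fun c => Rc c i) m) (cst 0).
Definition listingc n :=
  ifc n (itemc (modc (predc n) lenc) (divc (predc n) lenc)) lenc.
Definition newc i := andc (Rc (cst code_m1) i)
  (notc (exc (fun j => andc (ltc j i) (samec j i)))).
Definition countc := natrec (cst 0) (fun i n => addc n (newc i)) lenc.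

Let h2W psi : hasE2 (psi ++ phi). Proof. exact: lookup_cat. Qed.

Lemma Ev_same psi u v i j : Ev u (psi ++ phi) i -> Ev v (psi ++ phi) j ->
  Ev (samec u v) (psi ++ phi) (same X i j).
Proof.
move=> hu hv.
have -> : same X i j = ~~ `[< exists c, ~~ (`[< below X i `&` above c !=set0 >] ==
    `[< below X j `&` above c !=set0 >] :> nat) >].
  apply/asboolP/asboolPn => [h [c]|h c]; first by rewrite h eqxx.
  apply: contrapT => ne; apply: h; exists c; apply/negP => /eqP e; apply: ne.
  by move: e; do 2 case: `[< _ >].
apply/Ev_not/Ev_ex => // psi' t c ht; apply/Ev_not/Ev_eq;
  rewrite catA; apply: hR; rewrite -catA //; exact: EvW.
Qed.

Lemma Ev_covers psi u L : Ev u (psi ++ phi) L ->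
  Ev (coversc u) (psi ++ phi) (covers X L).
Proof.
move=> hu; have -> : covers X L =
    ~~ `[< exists j, ~~ `[< exists i, (i < L)%N && same X i j >] >].
  apply/asboolP/asboolPn => [h [j /asboolPn []]|h j].
    by have [i iL s] := h j; exists i; rewrite iL.
  apply: contrapT => ne; apply: h; exists j; apply/asboolPn => -[i /andP[iL s]].
  by apply: ne; exists i.
apply/Ev_not/Ev_ex => // psi' t j ht; apply/Ev_not/Ev_ex => [|psi2 t' i ht'].
  by rewrite catA.
apply: Ev_and => [|_]; first by apply: Ev_lt; ev.
by rewrite !catA; apply: Ev_same; rewrite -!catA; ev.
Qed.

Lemma Ev_len psi : Ev lenc (psi ++ phi) (len X).
Proof.
have [h1 h3] := leastP (covers_ex X01 finX).
apply: Ev_mu h1 h3 => psi' t n ht.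
by rewrite catA; apply: Ev_covers; rewrite -catA.
Qed.

Lemma Ev_below psi u i : Ev u (psi ++ phi) i ->
  Ev (Rc (cst code_m1) u) (psi ++ phi) `[< below X i !=set0 >].
Proof.
move=> hu; have := hR (Ev_cst code_m1 (psi ++ phi)) hu.
by rewrite above_m1 //; exact: below01.
Qed.

Lemma Ev_item psi u v i m : Ev u (psi ++ phi) i -> Ev v (psi ++ phi) m ->
  Ev (itemc u v) (psi ++ phi) (item X i m).
Proof.
move=> hu hv; apply: Ev_ifP => [|b0|_]; [exact: Ev_below| |exact: Ev_cst].
apply: (Ev1_app _ hv); apply: Ev_name_of => // psi' t c ht.
rewrite -above_sup //; last exact: below01.
by rewrite catA; apply: hR; rewrite -catA //; apply: EvW.
Qed.

Lemma Ev_listing t n : Ev t phi n -> Ev (listingc t) phi (listing X n).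
Proof.
move=> ht; have hl : Ev lenc phi (len X) by exact: (Ev_len [::]).
have l0 := len_gt0 X01 finX.
apply: (Ev_if ht); case: n ht => //= n ht _.
by apply: (@Ev_item [::]); [apply: Ev_mod|apply: Ev_div] => //; apply: (Ev_pred ht).
Qed.

Lemma Ev_new psi u i : Ev u (psi ++ phi) i -> Ev (newc u) (psi ++ phi) (newb X i).
Proof.
move=> hu; apply: Ev_and => [|_]; first exact: Ev_below.
apply/Ev_not/Ev_ex => // psi' t j ht; apply: Ev_and => [|_]; first by apply: Ev_lt; ev.
by rewrite catA; apply: Ev_same; rewrite -catA //; apply: EvW.
Qed.

Lemma Ev_count : Ev countc phi (count_list X).
Proof.
apply: Ev_natrec; [exact: (Ev_len [::])|exact: Ev_cst|].
by move=> psi u v m b hu hv; apply: Ev_add => //; apply: Ev_new.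
Qed.
End Programs.
End Listing.

(** * Questions about finite sets, by self-calling programs *)

Section Recursion.
Variable R : realType.
Implicit Types (x y s : R) (f g : nat -> nat) (S Z X P : set R).

Definition rangec (lF : nat) (lo : realc -> code) (q : code) (r : realc) : code :=
  andc (andc (memc lF r) (lo r)) (notc (gtc r q)).

(** Whether some element of X lies in (s, q]: ask Omega for the largest one, that
    is, for the x in X with s < x <= q and no element of X in (x, q].  The last
    condition is a recursive call, with x in the place of s. *)
Definition step (lF k lc lq : nat) (lo : realc -> code) : code :=
  foundc (omc (fun l => andc (rangec lF lo (var lq) (app1 l))
                             (notc (call (var lc) [:: lq, l, lc & levels k]))))
         (rangec lF lo (var lq)).

(** The program runs with q, a name of s and its own index in front of the [k] base arguments, at
    levels [k.+2], [k.+1] and [k]. *)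
Definition rec_index (lF k : nat) : nat :=
  step lF k k k.+2 (ltrc (app1 k.+1)) k.+3.

(** The outermost round starts from a rational instead of a named point, hence its own [lo]; the
    index and q are bound so that the recursive calls find them. *)
Definition in_range (lF : nat) (u v : code) : code := fun k =>
  let_ (cst (rec_index lF k)) (fun lc => let_ v (fun lq =>
    step lF k lc lq (gtc^~ u))) k.

Lemma card_le1_of Z : (forall x y, Z x -> Z y -> x = y) -> Z #<= `I_1.
Proof.
move=> h; have [[x Zx]|/nonemptyPn ->] := pselect (Z !=set0); last exact: card_ge0.
rewrite (_ : Z = [set x]) ?(card_le_eql card_set1) ?card_lexx //.
by apply/seteqP; split=> [y Zy|y ->] //=; exact: h.
Qed.

Lemma count_lt (T : eqType) (p q : pred T) z (t : seq T) :
  subpred p q -> z \in t -> q z -> ~~ p z -> (count p t < count q t)%N.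
Proof.
move=> pq; elim: t => //= a t IHt; rewrite inE => /orP[/eqP->|zt] qz pz.
  by rewrite qz (negPf pz) add0n add1n ltnS sub_count.
by rewrite -addnS leq_add ?IHt //; case: (p a) (pq a) => // ->.
Qed.

Lemma EvP_lt (r : realc) phi h s : hasE2 phi -> Ev1 r phi h -> names h s ->
  EvP (ltrc r) phi [set x | s < x].
Proof.
move=> h2 hr hs psi r' f x hr' hf /=; rewrite asboolb -(ltRP hs hf).
by apply: Ev_ltr => //; ev.
Qed.

Lemma kleene_congr e phi (a b : nat) : kleene e phi a -> a = b -> kleene e phi b.
Proof. by move=> h <-. Qed.

Section Base.
Variables (w : pfun [:: tN2; tN]) (lF : nat) (F : value tN2) (phi : seq input).
Hypotheses (hw : Omega R w) (h2 : hasE2 phi) (h1 : lookup phi 1 = Some (Inp w)).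
Hypotheses (hF : lookup phi lF = Some (total_input F)).
Hypotheses (cF : charfun01 R F) (finX : finite_set (carrier R F)).

Let X := carrier R F.
Let k := size phi.

Lemma EvS_range psi lo q v P : Ev v (psi ++ phi) q -> EvP lo (psi ++ phi) P ->
  EvS (rangec lF lo v) (psi ++ phi) (X `&` P `&` [set x | x <= val_code R q]).
Proof.
move=> hv hlo; apply: EvS_and; first apply: EvS_and => //.
  by apply: EvS_mem => //; exact: lookup_cat.
rewrite (_ : [set x | _] = ~` [set x | val_code R q < x]).
  by apply: EvP_not; apply: EvP_gt => //; exact: lookup_cat.
by apply/seteqP; split=> x /=; rewrite leNgt => /negP.
Qed.

Definition range s (q : nat) := X `&` [set x | s < x] `&` [set x | x <= val_code R q].

(** Of two points in the range the smaller sees the larger, so the submitted set has at most one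
    element in every case. The recursive value is demanded only for x in the range, since the
    membership test guards the call. *)
Lemma Ev_step psi lc lq c q lo s :
  let phi' := psi ++ phi in
  lookup phi' lc = Some (num c) -> lookup phi' lq = Some (num q) ->
  (k <= lc)%N -> (k <= lq)%N -> lc != lq ->
  EvP lo phi' [set x | s < x] ->
  (forall x h, names h x -> range s q x ->
     kleene c [:: num q, total_input (h : value tN1), num c & phi]
       `[< range x q !=set0 >]) ->
  Ev (step lF k lc lq lo) phi' `[< range s q !=set0 >].
Proof.
move=> phi' hc hq kc kq cq hlo hrec.
have X01 : X `<=` @I01 R := @carrier_I01 R F.
pose Z := range s q `&` [set x | ~ (range x q !=set0)].
have hr : EvS (rangec lF lo (var lq)) phi' (range s q).
  by apply: EvS_range => //; apply: Ev_var.
apply: (Ev_omega hw (Z := Z)) => //.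
- exact: lookup_cat.
- exact: lookup_cat.
- move=> psi' h; set r := app1 _.
  have hl : lookup (total_input h :: psi' ++ phi') (size (psi' ++ phi')) =
    Some (total_input h) by exact: lookup_size.
  have hR : EvS (rangec lF lo (var lq)) (total_input h :: psi' ++ phi') (range s q).
    exact: (@EvSW _ (total_input (h : value tN1) :: psi') _ _ _ hr).
  rewrite /chi; have -> : `[< exists2 x, Z x & names h x >] =
      `[< exists2 x, range s q x & names h x >] &&
      ~~ `[< exists x, names h x /\ range x q !=set0 >].
    apply/asboolP/andP => [[x [rx nx] hx]|[/asboolP[x rx hx] /asboolPn n]].
      split; first by apply/asboolP; exists x.
      by apply/asboolPn => -[y [hy ry]]; apply: nx; rewrite (names_unique hx hy).
    by exists x => //; split=> // ry; apply: n; exists x.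
  apply: Ev_and; first exact: (EvS_app hR (Ev1_app1 hl)).
  case/asboolP => x rx hx.
  have lts l : l \in levels k -> (l < k)%N by rewrite mem_levels.
  have l1 := lookup_lt hc; have l2 := lookup_lt hq.
  apply: Ev_not; apply: (@Ev_call _ _ _ c).
  + exact/Ev_var/lookup_cons/lookup_cat.
  + rewrite /= !inE !mem_levels levels_uniq size_cat; apply/andP.
    move: cq l1 l2 kc kq; rewrite /phi' !size_cat -/k; lia.
  + rewrite /=; move: l1 l2; rewrite /phi' !size_cat -/k => l1 l2.
    apply/and4P; split; try lia.
    by apply/allP => l /lts; lia.
  rewrite /= (lookup_nth hl) (lookup_nth (lookup_cons _ (lookup_cat _ hc))).
  rewrite (lookup_nth (lookup_cons _ (lookup_cat _ hq))).
  rewrite -/(args_at _ _) /phi' catA -cat_cons args_at_levels.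
  apply: kleene_congr (hrec x h hx rx) _; congr (nat_of_bool _).
  apply/asboolP/asboolP => [ry|[y [hy]]]; first by exists x.
  by rewrite (names_unique hy hx).
- by move=> x [[[/X01]]].
- apply: card_le1_of => x y [rx nx] [ry ny].
  move: rx ry => [[Xx sx] xq] [[Xy sy] yq].
  by case: (ltgtP x y) => // lt; [case: nx; exists y|case: ny; exists x].
- move=> r0; have [x rx xP] : exists2 x, range s q x & forall y, range s q y -> y <= x.
    by apply: finite_max r0; apply: sub_finite_set finX => x [[]].
  exists x; split=> //; split=> // -[y [[Xy xy] yq]].
  have : range s q y.
    by split=> //; split=> //=; move: rx => [[_ /= sx] _]; apply: lt_trans xy.
  by move/xP; rewrite leNgt xy.
Qed.

(** Induction on the number of points of X above s: a call is made only for an x in X with s < x,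
    and x is not above itself. *)
Lemma kleene_rec q s h : names h s ->
  kleene (rec_index lF k)
    [:: num q, total_input (h : value tN1), num (rec_index lF k) & phi]
    `[< range s q !=set0 >].
Proof.
have [xs Xxs] := (finite_seqP _).1 finX.
have [n] := ubnP (count (fun x => s < x) xs).
elim: n => // n IHn in s h *; rewrite ltnS => cn hs.
set c := rec_index lF k.
pose phi' := [:: num q, total_input (h : value tN1), num c & phi].
apply: (@Ev0 _ phi').
have hl : lookup phi' k.+1 = Some (total_input (h : value tN1)).
  exact/lookup_cons/(@lookup_size _ [:: num c & phi]).
apply: (@Ev_step [:: num q; total_input (h : value tN1); num c] _ _ c q _ s) => //.
- exact/lookup_cons/lookup_cons/lookup_size.
- exact: (@lookup_size _ [:: total_input (h : value tN1), num c & phi]).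
- by rewrite -addn2 leq_addr.
- by rewrite -{1}[k]addn0 -addn2 eqn_add2l.
- apply: EvP_lt hs; first by do 3 apply: lookup_cons.
  exact: Ev1_app1 hl.
move=> x h' hx [[Xx sx] _]; apply: IHn hx.
apply: leq_trans cn; have xxs : x \in xs by move: Xx; rewrite /X Xxs.
by apply: (@count_lt _ _ _ x) => //= [y|]; [exact: lt_trans|rewrite ltxx].
Qed.

End Base.

Lemma Ev_in_range w lF (F : value tN2) phi u v c q :
  Omega R w -> hasE2 phi -> lookup phi 1 = Some (Inp w) ->
  lookup phi lF = Some (total_input F) -> charfun01 R F ->
  finite_set (carrier R F) -> Ev u phi c -> Ev v phi q ->
  Ev (in_range lF u v) phi `[< below (carrier R F) q `&` above c !=set0 >].
Proof.
move=> hw h2 h1 hF cF fX hu hv psi; set phi' := psi ++ phi; set k := size phi'.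
have h2' : hasE2 phi' by exact: lookup_cat.
have h1' : lookup phi' 1 = Some (Inp w) by exact: lookup_cat.
have hF' : lookup phi' lF = Some (total_input F) by exact: lookup_cat.
have -> : below (carrier R F) q `&` above c = range F (val_code R c) q.
  by rewrite /range /below setIAC.
set m := rec_index lF k.
apply: (@Ev0 (let_ (cst m) (fun lc => let_ v (fun lq => step lF k lc lq (gtc^~ u)))) phi').
apply: Ev_let_; first exact: Ev_cst.
move=> psi1; apply: (Ev_let_ (b := q)).
  by apply: EvC; rewrite catA; apply: EvW.
move=> psi2; set lc := size (psi1 ++ phi'); set lq := size (psi2 ++ _).
pose psi3 := num q :: psi2 ++ num m :: psi1.
have e : [:: num q & psi2 ++ num m :: psi1 ++ phi'] = psi3 ++ phi'.
  by rewrite /psi3 /= -catA.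
have hq : lookup [:: num q & psi2 ++ num m :: psi1 ++ phi'] lq = Some (num q).
  exact: lookup_size.
have hc : lookup [:: num q & psi2 ++ num m :: psi1 ++ phi'] lc = Some (num m).
  exact/lookup_cons/lookup_cat/lookup_size.
rewrite e in hq hc *.
apply: (@Ev_step w lF F phi' hw h2' h1' hF' cF fX psi3 lc lq m q) => //.
- by rewrite /lc size_cat leq_addl.
- by rewrite /lq size_cat /= [size (_ ++ phi')]size_cat -/k; lia.
- by rewrite /lq size_cat /= -/lc; lia.
- apply: EvP_gt; first exact: lookup_cat.
  by rewrite catA; apply: EvW.
- by move=> x h hx _; exact: (kleene_rec hw h2' h1' hF' cF fX q hx).
Qed.
End Recursion.

(** * Questions about sets of known size, by $\Omega_1$ *)

Section Counted.
Variable R : realType.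
Implicit Types (x y : R) (f g : nat -> nat) (S Z X P : set R).

(** [beats P x] are the points that come after [x] when the elements of [P] are
    ranked above all other reals. *)
Definition beats P x : set R := [set y |
  if `[< P x >] then P y /\ x < y else P y \/ x < y].

Definition beatsc (C : realc -> code) (r r' : realc) : code :=
  ifc (C r) (andc (C r') (ltrc r r')) (orc (C r') (ltrc r r')).

Definition neqc (r r' : realc) : code := orc (ltrc r r') (ltrc r' r).

(** Whether a set [S] of known size [k] meets [P]: Omega_1 yields the last
    element of [S] in the ranking of [beats P]. *)
Fixpoint meets (k : nat) (M C : realc -> code) : code :=
  if k is k'.+1 then
    foundc (omc (fun l => andc (M (app1 l))
        (notc (meets k' (fun r => andc (M r) (neqc (app1 l) r)) (beatsc C (app1 l))))))
      (fun r => andc (M r) (C r))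
  else cst 0.

Lemma card_remove n S x : S #= `I_n.+1 -> S x -> S `\ x #= `I_n.
Proof.
move=> Sn Sx; have /finite_setP[m hm] : finite_set (S `\ x).
  by apply: sub_finite_set (_ : finite_set S) => [y []//|]; apply/finite_setP; exists n.+1.
have Sm : S #= `I_m.+1 by apply/eq_cardSP; exists x.
have /card_eq_II[<-] // : `I_m.+1 #= `I_n.+1.
by apply: card_eq_trans Sn; rewrite card_eq_sym.
Qed.

Lemma EvP_beats C phi P r x h : hasE2 phi -> EvP C phi P -> Ev1 r phi h -> names h x ->
  EvP (beatsc C r) phi (beats P x).
Proof.
move=> h2 hC hr hx psi r' f y hr' hf.
have h2' : hasE2 (psi ++ phi) by exact: lookup_cat.
have hxy : Ev (ltrc r r') (psi ++ phi) (x < y)%R.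
  by rewrite -(ltRP hx hf); apply: Ev_ltr => //; exact: Ev1W.
have hPy := hC _ _ _ _ hr' hf.
rewrite /beatsc /beats /=.
apply: (Ev_if (hC psi r h x (Ev1W hr) hx)); case: asboolP => // _ _.
  by rewrite asbool_and asboolb; apply: Ev_and.
by rewrite asbool_or asboolb; apply: Ev_or.
Qed.

Lemma EvP_neq phi r x h : hasE2 phi -> Ev1 r phi h -> names h x ->
  EvP (neqc r) phi [set y | y <> x].
Proof.
move=> h2 hr hx psi r' f y hr' hf.
have -> : `[< [set y | y <> x] y >] = ltRb h f || ltRb f h.
  rewrite (ltRP hx hf) (ltRP hf hx) -neq_lt eq_sym.
  by apply/asboolP/idP => /eqP.
by apply: Ev_or; apply: Ev_ltr => //; try exact: Ev1W; exact: lookup_cat.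
Qed.

(** The witness is the largest point of [S] in [P], or the largest point of [S] if none is in [P];
    so it lies in [P] exactly when [S] meets [P]. *)
Lemma beats_last S P : finite_set S -> S !=set0 ->
  exists z, [/\ S z, (S `&` P !=set0 -> P z) & forall y, S y -> ~ beats P z y].
Proof.
move=> fS S0; have [SP|SP] := pselect (S `&` P !=set0).
  have [|z [Sz Pz] zP] := finite_max _ SP; first by apply: sub_finite_set fS => y [].
  exists z; split=> // y Sy; rewrite /beats /= asboolT // => -[Py zy].
  by have := zP y (conj Sy Py); rewrite leNgt zy.
have [z Sz zP] := finite_max fS S0; exists z; split=> // y Sy.
rewrite /beats /=; case: asboolP => [Pz|nPz]; first by case: SP; exists z.
by case=> [Py|]; [case: SP; exists y|rewrite ltNge zP].
Qed.

Lemma beats_total P x y : x <> y -> beats P x y \/ beats P y x.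
Proof.
move=> xy; rewrite /beats /=; have /orP : (x < y) || (y < x) by rewrite -neq_lt; apply/eqP.
by case: asboolP => Px; case: asboolP => Py; tauto.
Qed.

(** The part of [S] in [P] cannot be submitted, as it may be empty or large; the last point always
    forms a one-element set. The test for being last replaces [P] by [beats P x], so the induction
    is over all [P]. *)
Lemma Ev_meets w n M C phi S P : Omega_1 R w -> hasE2 phi ->
  lookup phi 1 = Some (Inp w) -> S `<=` @I01 R -> S #= `I_n ->
  EvS M phi S -> EvP C phi P -> Ev (meets n M C) phi `[< S `&` P !=set0 >].
Proof.
move=> hw; elim: n M C phi S P => [|n IHn] M C phi S P h2 h1 S01 Sn hM hC.
  rewrite asboolF; first exact: Ev_cst.
  by move=> [x [Sx _]]; move: Sn; rewrite II0 card_eq0 => /eqP S0; rewrite S0 in Sx.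
pose Z := S `&` [set x | ~ ((S `\ x) `&` beats P x !=set0)].
have fS : finite_set S by apply/finite_setP; exists n.+1.
have S0 : S !=set0 by have /eq_cardSP[x] := Sn; exists x.
have [z [Sz zP zlast]] := beats_last P fS S0.
have Ez : Z = [set z].
  apply/seteqP; split=> [x [Sx nx]|x ->] /=; last first.
    by split=> // -[y [[Sy _]]]; apply: zlast.
  apply: contrapT => xz; have [b|b] := beats_total P xz; last exact: zlast b.
  by apply: nx; exists z; split=> //; split=> // /esym.
apply: (Ev_omega hw (Z := Z)) => //.
- move=> psi h; set r := app1 _; set phi' := _ :: _.
  have h2' : hasE2 phi' by exact/lookup_cons/lookup_cat.
  have hr : Ev1 r phi' h by exact/Ev1_app1/lookup_size.
  have hM' : EvS M phi' S := @EvSW _ (total_input (h : value tN1) :: psi) _ _ _ hM.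
  have hC' : EvP C phi' P := @EvPW _ (total_input (h : value tN1) :: psi) _ _ _ hC.
  rewrite /chi; have -> : `[< exists2 x, Z x & names h x >] =
      `[< exists2 x, S x & names h x >] &&
      ~~ `[< exists x, names h x /\ (S `\ x) `&` beats P x !=set0 >].
    apply/asboolP/andP => [[x [Sx nx] hx]|[/asboolP[x Sx hx] /asboolPn nx]].
      split; first by apply/asboolP; exists x.
      by apply/asboolPn => -[y [hy ry]]; apply: nx; rewrite (names_unique hx hy).
    by exists x => //; split=> // ry; apply: nx; exists x.
  apply: Ev_and; first exact: (EvS_app hM' hr).
  case/asboolP => x Sx hx; apply: Ev_not.
  rewrite (_ : (exists x, _) = ((S `\ x) `&` beats P x !=set0)); last first.
    rewrite propeqE; split=> [[y [hy]]|?]; last by exists x.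
    by rewrite (names_unique hx hy).
  apply: IHn => //.
  + exact/lookup_cons/lookup_cat.
  + by move=> y [/S01].
  + exact: card_remove.
  + exact: EvS_and (EvP_neq _ _ hx).
  + exact: EvP_beats hx.
- by move=> x []; move/S01.
- by rewrite Ez card_set1.
- exact: EvS_and.
- by move=> SP; exists z; rewrite Ez; split=> //; split=> //; exact: zP.
Qed.
End Counted.

(** * Assembly of the clusters *)

Section Clusters.
Variable R : realType.
Implicit Types (x y : R) (f g : nat -> nat) (S Z X P : set R).

(** [listing] is the canonical output; what each instance supplies is a program for the questions
    about (c, q]. *)
Lemma omega_listing_cluster D0 D :
  (forall X, D X -> finite_set X) ->
  (forall F, Omega_on D F -> yields_omega D0 F) ->
  (forall w, Omega_on (R := R) D0 w -> exists Rc : code -> code -> code,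
     forall phi (X : value tN2) u v c q, charfun01 R X -> D (carrier R X) -> hasE2 phi ->
       lookup phi 1 = Some (Inp w) -> lookup phi 3 = Some (total_input X) ->
       Ev u phi c -> Ev v phi q ->
       Ev (Rc u v) phi `[< below (carrier R X) q `&` above c !=set0 >]) ->
  class_in_cluster (Omega_on (R := R) D0) (Omega_on (R := R) D).
Proof.
move=> finD h1 h2.
apply: (@class_in_cluster_canonical [:: tN2] [:: tN] _ _ [:: tN2] [:: tN] _ _
  (fun a : args [:: tN2] => listing (carrier R a.1))) => //.
  move=> a [_ Da]; apply: listing_includes; [exact: carrier_I01|exact: finD].
move=> w /h2[Rc hRc]; exists (listingc Rc (var 2)) => -[X []] [/= cX DX] [n []] /=.
apply: Ev_listing => //; [exact: carrier_I01|exact: finD| |exact: Ev_var].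
by move=> psi u v c q hu hv; apply: hRc => //; apply: lookup_cat.
Qed.

Lemma omega_fin_cluster D : (forall X, D X -> finite_set X) ->
  (forall X, X #<= `I_1 -> D X) ->
  class_in_cluster (Omega R) (Omega_on (R := R) D).
Proof.
move=> finD D1; apply: omega_listing_cluster => //.
  by move=> F hF; apply: yields_omega_fin hF.
move=> w hw; exists (in_range 3) => phi X u v c q cX DX h2 h1 h3 hu hv.
exact: Ev_in_range (finD _ DX) hu hv.
Qed.

Lemma omega_eq_cluster n : (0 < n)%N ->
  class_in_cluster (Omega_1 R) (Omega_eq R n).
Proof.
move=> n0; apply: omega_listing_cluster.
- by move=> X Xn; apply/finite_setP; exists n.
- by move=> F hF; apply: yields_omega1 hF.
move=> w hw; exists (fun u v => meets n (memc 3) (fun r => andc (gtc r u) (notc (gtc r v)))).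
move=> phi X u v c q cX DX h2 h1 h3 hu hv.
have -> : below (carrier R X) q `&` above c =
    carrier R X `&` [set x | val_code R c < x /\ ~ (val_code R q < x)].
  apply/seteqP; split=> x /=.
    by move=> [[Xx xq] cx]; split=> //; split=> //; apply/negP; rewrite -leNgt.
  by move=> [Xx [cx /negP]]; rewrite -leNgt.
apply: (Ev_meets hw) => //; [exact: carrier_I01|exact: EvS_mem|].
move=> psi r f x hr hf /=; rewrite asbool_and; apply: Ev_and => [|_].
  by apply: (EvP_gt h2 hu hr hf).
exact: (EvP_not (EvP_gt h2 hv) hr hf).
Qed.

(** Only fibers are submitted, so [D0] is required of them: at most one element for an injective Y,
    exactly one if Y is also surjective. *)
Lemma fibers_cluster D0 (P : args [:: tN2; tN2] -> Prop) :
  (forall a, P a -> inj_input R a) ->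
  (forall a, P a -> forall n, D0 (fiber (R := R) a.1 a.2.1 n)) ->
  ((forall F, enum_on R P F -> yields_omega D0 F) ->
   class_in_cluster (Omega_on (R := R) D0) (enum_on R P)) /\
  ((forall F, BW_on R P F -> yields_omega D0 F) ->
   class_in_cluster (Omega_on (R := R) D0) (BW_on R P)).
Proof.
move=> Pinj PD; split=> h.
- apply: (@class_in_cluster_canonical [:: tN2] [:: tN] _ _ [:: tN2; tN2] [:: tN; tN] _ _
    (fun a : args [:: tN2; tN2] => enum_of R a.1 a.2.1)) => //.
    by move=> a /Pinj[_ fY inj]; apply: enum_of_enumerates.
  (* A, Y, n, m, [w] and [E2] have levels 5 down to 0. *)
  move=> w hw; exists (enumc 5 4 (var 3) (var 2)) => -[A [Y []]] Pa [n [m []]].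
  have [/= cA fY _] := Pinj _ Pa.
  by apply: (Ev_enum hw _ _ _ _ cA fY (PD _ Pa)) => //; apply: Ev_var.
- apply: (@class_in_cluster_canonical [:: tN2] [:: tN] _ _ [:: tN2; tN2] [:: tN] _ _
    (fun a : args [:: tN2; tN2] => sup_of R a.1)) => //.
    by move=> a _; apply: names_sup_of.
  move=> w hw; exists (supc 4 3 (var 2)) => -[A [Y []]] Pa [m []].
  have [/= cA fY _] := Pinj _ Pa.
  by apply: (Ev_sup hw _ _ _ _ cA fY (PD _ Pa)) => //; apply: Ev_var.
Qed.

(** Exact size and upper bound are treated together: the exact count meets [Q], and any answer
    meeting [Q] is a bound. *)
Lemma card_cluster (Q : args [:: tN2] -> nat -> Prop) :
  (forall a n, Q a n -> carrier R a.1 #<= `I_n) ->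
  (forall a n, carrier R a.1 #= `I_n -> Q a n) ->
  class_in_cluster (Omega R) (@described [:: tN2] [::]
    (set_input (fun X : set R => finite_set X)) Q).
Proof.
move=> Qle Qeq.
apply: (@class_in_cluster_canonical [:: tN2] [:: tN] _ _ [:: tN2] [::] _ _
  (fun a : args [:: tN2] => count_list (carrier R a.1))).
- move=> F hF; apply: yields_ge_card => a; have [h1 h2] := hF a; split=> //.
  by move=> /h1[n Qn hn]; exists n => //; apply: Qle.
- by move=> a [_ fa]; apply/Qeq/card_count_list => //; exact: carrier_I01.
move=> w hw; exists (countc (in_range 2)) => -[X []] [/= cX fX] [].
apply: Ev_count => //; first exact: carrier_I01.
move=> psi u v c q hu hv.
by apply: Ev_in_range hw _ _ _ cX fX hu hv; apply: lookup_cat.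
Qed.
End Clusters.

Local Close Scope ring_scope.
Local Close Scope classical_set_scope.
Local Close Scope card_scope.

Theorem theorem4p4 (R : realType) :
  [/\ forall n : nat, (1 <= n)%N ->
        class_in_cluster (Omega_1 R) (Omega_eq R n),
      class_in_cluster (Omega_1 R) (weak_enumeration R)
    & class_in_cluster (Omega_1 R) (weak_Omega_BW R)] /\
  [/\ class_in_cluster (Omega R) (Omega_fin R),
      forall n : nat, (1 <= n)%N ->
        class_in_cluster (Omega R) (Omega_le R n),
      class_in_cluster (Omega R) (Omega_card_fin R)
    & class_in_cluster (Omega R) (Omega_ge_card_fin R)] /\
  [/\ class_in_cluster (Omega R) (enumeration R)
    & class_in_cluster (Omega R) (Omega_BW R)].
Proof.
have fin1 n X : (X #<= `I_n)%card -> finite_set X.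
  by move=> Xn; apply/finite_set_leP; exists n.
have [|en bw] := @fibers_cluster R (fun X => X #<= `I_1)%card (inj_input R) (fun=> id).
  by move=> a [_ _ inj] n; apply: fiber_le1.
have [|wen wbw] := @fibers_cluster R (fun X => X #= `I_1)%card (bij_input R) (fun=> @proj1 _ _).
  by move=> a [[_ _ inj] surj] n; apply: fiber_eq1.
split; [split|split; split].
- exact: omega_eq_cluster.
- exact: wen (@yields_weak_enumeration R).
- exact: wbw (@yields_weak_BW R).
- by apply: omega_fin_cluster => // X /fin1.
- move=> n n0; apply: omega_fin_cluster => X; first exact: fin1.
  by move=> X1; apply: card_le_trans X1 _; rewrite card_le_II.
- by apply: card_cluster => // a n; rewrite card_eq_le => /andP[].
- by apply: card_cluster => // a n; rewrite card_eq_le => /andP[].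
- exact: en (@yields_enumeration R).
- exact: bw (@yields_BW R).
Qed.
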